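(* Let $G$ be a compact Lie group and let $A: C^{\infty}(G) \rightarrow C(G)$ be a linear operator satisfying the positive maximum principle, so that for all $f\in C^\infty(G)$, $\sigma\in G$, $$Af(\sigma) = -c(\sigma)f(\sigma) + \sum_{i=1}^{d}b_{i}(\sigma)X_{i}f(\sigma) + \sum_{j,k = 1}^{d}a_{jk}(\sigma)X_{j}X_{k}f(\sigma) + \int_{G}\left(f(\sigma \tau) - f(\sigma) - \sum_{i=1}^{d}x_{i}(\tau)X_{i}f(\sigma)\right)\mu(\sigma, d\tau),$$ where $c,b_i,a_{jk}:G\to\mathbb{R}$, $c\ge0$, $(a_{jk}(\sigma))$ is symmetric and non-negative definite for each $\sigma \in G$, and $\mu$ is a Lévy kernel. Assume that (i) the functions $a_{jk}, b_i, c$ are continuous for all $i,j,k$; (ii) the mappings $g \mapsto \int_{U}h(\tau)\left(\sum_{i=1}^{d}x_{i}(\tau)^{2}\right)\mu(g, d\tau)$ are continuous on $G$ for all $h \in C_{b}(U)$, and the mappings $g \mapsto \int_{U^{c}}k(\tau)\mu(g, d\tau)$ are continuous on $G$ for all $k \in C_{b}(U^{c})$. Define $j_{A}(\sigma,\pi)=\pi(\sigma)^{-1}A\pi(\sigma)$. Then for each $\pi \in \widehat{G}$, $\sigma \in G$, $$j_{A}(\sigma, \pi) = -c(\sigma)I_{\pi} + \sum_{i=1}^{d}b_{i}(\sigma)d\pi(X_{i}) + \sum_{j,k = 1}^{d}a_{jk}(\sigma)d\pi(X_{j})d\pi(X_{k}) + \int_{G}\left(\pi(\tau) - I_{\pi}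 - \sum_{i=1}^{d}x_{i}(\tau)d\pi(X_{i})\right)\mu(\sigma, d\tau).$$
   Context: $G$ is a compact Lie group of dimension $d$ with neutral element $e$, Lie algebra $\mathfrak{g}$, exponential map $\exp$ and Borel $\sigma$-algebra $\mathcal{B}(G)$. A basis $\{X_1,\dots,X_d\}$ of $\mathfrak{g}$ is fixed; elements $X\in\mathfrak{g}$ act on smooth functions as left-invariant vector fields, $Xf(\sigma)=\frac{d}{du}f(\sigma\exp(uX))|_{u=0}$. $C_b(Y)$ is the space of bounded continuous real-valued functions on $Y$. A canonical co-ordinate neighbourhood of $e$ is an open neighbourhood $U$ of $e$ together with co-ordinate functions $x_1,\dots,x_d\in C_c^\infty(G)$ (real-valued) such that $g\mapsto (x_1(g),\dots,x_d(g))$ is a diffeomorphism of $U$ onto an open neighbourhood of $0$ in $\mathbb{R}^d$, sending $e$ to $0$, and $g=\exp(\sum_{i=1}^d x_i(g)X_i)$ for $g\in U$. One such $U$ with functions $x_1,\dots,x_d$ is fixed. Positive maximum principle for $A$: whenever $f$ is a real-valued smooth function and $\rho\in G$ satisfies $f(\rho) = \sup_{\tau \in G}f(\tau) \geq 0$, then $Af(\rho) \leq 0$. $A$ maps real-valued functions to real-valued functions and is extended complex-linearly to complex-valued smooth functions. A Borel measure $\mu$ on $G$ is a Lévy measure if $\mu(\{e\})=0$ and, for every canonical co-ordinate neighbourhood $U$ of $e$, $\int_U \sum_{i=1}^d x_i(g)^2\,\mu(dg)<\infty$ and $\mu(U^c)<\infty$. A Lévy kernel is a mapping $\mu:G\times\mathcal{B}(G)\to[0,\infty]$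 with $\mu(g,\cdot)$ a Lévy measure for every $g\in G$. $\widehat{G}$ is the unitary dual of $G$ (equivalence classes of irreducible unitary representations, with a representative chosen in each class); $\pi\in\widehat{G}$ acts by unitary matrices on a complex Hilbert space $V_\pi$ of dimension $d_\pi<\infty$ with a fixed orthonormal basis, and $\pi_{ij}(g)=\pi(g)_{ij}$. $A\pi(\sigma)$ is the $d_\pi\times d_\pi$ matrix with entries $A\pi_{ij}(\sigma)$. $I_\pi$ is the identity matrix on $V_\pi$, and $d\pi(X)=\frac{d}{du}\pi(\exp(uX))|_{u=0}$ is the derived representation of $\mathfrak{g}$. Matrix-valued integrals are taken entrywise. *)

(* Defs.v *)
From HB Require Import structures.
From mathcomp Require Import all_boot all_order all_algebra.
From mathcomp Require Import all_classical all_reals all_analysis.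
From mathcomp Require Import complex.

Set Implicit Arguments.
Unset Strict Implicit.
Unset Printing Implicit Defensive.

Import Order.TTheory GRing.Theory Num.Theory.
Import numFieldNormedType.Exports.

Local Open Scope classical_set_scope.
Local Open Scope ring_scope.
Local Open Scope complex_scope.

(* [Ck k O f] is meant for O open and V, W finite-dimensional (V is R,
   'rV_d or 'rV_d * 'rV_d below), where the existence and continuity of all
   iterated directional derivatives up to order k is C^k regularity. *)
Fixpoint Ck (R : realType) (V W : normedModType R) (k : nat) (O : set V)
    (f : V -> W) : Prop :=
  (forall x, O x -> {for x, continuous f}) /\
  if k is k'.+1 then
    forall v, (forall x, O x -> derivable f x v) /\
              Ck k' O (fun x => 'D_v f x)
  else True.

Definition smooth_on (R : realType) (V W : normedModType R) (O : set V)
    (f : V -> W) : Prop :=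
  forall k, Ck k O f.

Record chart (R : realType) (d : nat) (G : topologicalType) := Chart {
  chart_dom : set G;
  chart_im : set 'rV[R]_d;
  chart_fun : G -> 'rV[R]_d;
  chart_inv : 'rV[R]_d -> G;
  chart_dom_open : open chart_dom;
  chart_im_open : open chart_im;
  chart_funP : forall g, chart_dom g -> chart_im (chart_fun g);
  chart_invP : forall v, chart_im v -> chart_dom (chart_inv v);
  chart_funK : forall g, chart_dom g -> chart_inv (chart_fun g) = g;
  chart_invK : forall v, chart_im v -> chart_fun (chart_inv v) = v;
  chart_fun_continuous :
    forall g, chart_dom g -> {for g, continuous chart_fun};
  chart_inv_continuous :
    forall v, chart_im v -> {for v, continuous chart_inv}
}.

(* Smoothness of a map from an open subset O of a finite-dimensional normed
   space into the manifold with the given atlas. *)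
Definition smooth_into (R : realType) (d : nat) (G : topologicalType)
    (atl : set (chart R d G)) (V : normedModType R) (O : set V) (p : V -> G) :
    Prop :=
  (forall v, O v -> {for v, continuous p}) /\
  forall c, atl c ->
    smooth_on (O `&` p @^-1` chart_dom c) (fun v => chart_fun c (p v)).

(* Real Lie groups of dimension d.  Second countability is not required: it is
   automatic for compact groups.  [lie_atlas_compatible] says that the
   transition maps are smooth; the last two fields say that multiplication and
   inversion are smooth, read in charts of the source.  The point of the
   underlying pointed type plays no role; it is needed to form the measurable
   space [borel G]. *)
HB.mixin Record isLieGroup (R : realType) (d : nat) G
    of PointedTopological G & Group G := {
  lie_atlas : set (chart R d G);
  lie_hausdorff : hausdorff_space G;
  lie_atlas_cover : forall g : G, exists2 c, lie_atlas c & chart_dom c g;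
  lie_atlas_compatible : forall c, lie_atlas c ->
    smooth_into lie_atlas (chart_im c) (chart_inv c);
  lie_mul_smooth : forall c1 c2, lie_atlas c1 -> lie_atlas c2 ->
    smooth_into lie_atlas (chart_im c1 `*` chart_im c2)
      (fun v : 'rV[R]_d * 'rV[R]_d =>
         (chart_inv c1 v.1 * chart_inv c2 v.2)%g : G);
  lie_inv_smooth : forall c, lie_atlas c ->
    smooth_into lie_atlas (chart_im c)
      (fun v => ((chart_inv c v)^-1)%g : G)
}.

#[short(type="lieGroupType")]
HB.structure Definition LieGroup (R : realType) (d : nat) :=
  { G of PointedTopological G & Group G & isLieGroup R d G }.

Definition atlas (R : realType) (d : nat) (G : lieGroupType R d) :
  set (chart R d G) := lie_atlas.

Arguments atlas {R d} G.

Notation borel G := (g_sigma_algebraType (@open G)).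

Definition smooth (R : realType) (d : nat) (G : lieGroupType R d)
    (f : G -> R) : Prop :=
  forall c, atlas G c -> smooth_on (chart_im c) (fun v => f (chart_inv c v)).

(* A tangent vector at the neutral element, as a derivation of C^oo(G) at e.
   Functionals here are total on G -> R; the last clause makes a derivation
   determined by its values on smooth functions. *)
Definition tangent_vector (R : realType) (d : nat) (G : lieGroupType R d)
    (D : (G -> R) -> R) : Prop :=
  [/\ forall (a : R) f g, smooth f -> smooth g ->
        D (fun s => a * f s + g s) = a * D f + D g,
      forall f g, smooth f -> smooth g ->
        D (fun s => f s * g s) = f 1%g * D g + g 1%g * D f &
      forall f, ~ smooth f -> D f = 0].

Definition tangent_pred (R : realType) (d : nat) (G : lieGroupType R d) :
  {pred (G -> R) -> R^o} := fun D => `[< tangent_vector D >].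

Lemma tangent_pred_submod (R : realType) (d : nat) (G : lieGroupType R d) :
  submod_closed (@tangent_pred R d G).
Proof.
split=> [|a D1 D2].
  by apply/asboolP; split=> * /=; rewrite ?mulr0 ?addr0.
have fE h : (a *: D1 + D2) h = a * D1 h + D2 h by [].
move=> /asboolP[lin1 lb1 ns1] /asboolP[lin2 lb2 ns2]; apply/asboolP; split.
- move=> k f g sf sg; rewrite !fE lin1 // lin2 //.
  by rewrite !mulrDr addrACA mulrCA.
- move=> f g sf sg; rewrite !fE lb1 // lb2 //.
  by rewrite !mulrDr addrACA mulrCA [a * (g _ * _)]mulrCA.
- by move=> f nf; rewrite fE ns1 // ns2 // mulr0 addr0.
Qed.

HB.instance Definition _ (R : realType) (d : nat) (G : lieGroupType R d) :=
  GRing.isSubmodClosed.Build R ((G -> R) -> R^o) (@tangent_pred R d G)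
    (@tangent_pred_submod R d G).

(* The vector space underlying the Lie algebra, realised as the tangent space
   at e; the bracket is not used. *)
Record lie_algebra (R : realType) (d : nat) (G : lieGroupType R d) :=
  LieAlgebra {
    lie_derivation :> (G -> R) -> R^o;
    _ : lie_derivation \in @tangent_pred R d G }.

HB.instance Definition _ (R : realType) (d : nat) (G : lieGroupType R d) :=
  [isSub for @lie_derivation R d G].
HB.instance Definition _ (R : realType) (d : nat) (G : lieGroupType R d) :=
  [Choice of lie_algebra G by <:].
HB.instance Definition _ (R : realType) (d : nat) (G : lieGroupType R d) :=
  [SubChoice_isSubLmodule of lie_algebra G by <:].

Definition is_basis (R : realType) (d : nat) (G : lieGroupType R d)
    (X : 'I_d -> lie_algebra G) : Prop :=
  bijective (fun v : 'rV[R]_d => \sum_(i < d) v 0 i *: X i).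

(* For every X, u |-> expG (u X) is the one-parameter subgroup with initial
   velocity X; this determines expG. *)
Definition is_exponential (R : realType) (d : nat) (G : lieGroupType R d)
    (expG : lie_algebra G -> G) : Prop :=
  forall X : lie_algebra G,
  [/\ smooth_into (atlas G) setT (fun u : R => expG (u *: X)),
      forall u v : R, expG ((u + v) *: X) = (expG (u *: X) * expG (v *: X))%g &
      forall f : G -> R, smooth f ->
        is_derive (0 : R) (1 : R) (fun u : R => f (expG (u *: X)) : R) (X f)].

Definition left_field (R : realType) (d : nat) (G : lieGroupType R d)
    (expG : lie_algebra G -> G) (X : lie_algebra G) (f : G -> R) : G -> R :=
  fun s => derive1 (fun u : R => f (s * expG (u *: X))%g : R) 0.

Definition canonical_coordinates (R : realType) (d : nat)
    (G : lieGroupType R d) (expG : lie_algebra G -> G)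
    (X : 'I_d -> lie_algebra G) (U : set G) (x : 'I_d -> G -> R) : Prop :=
  let xv := fun g : G => (\row_(i < d) x i g : 'rV[R]_d) in
  [/\ open U /\ U 1%g,
      forall i, smooth (x i) /\ compact (closure [set g : G | x i g != 0]),
      open (xv @` U) /\ xv 1%g = 0,
      exists y : 'rV[R]_d -> G,
        (forall g, U g -> y (xv g) = g) /\ smooth_into (atlas G) (xv @` U) y &
      forall g, U g -> g = expG (\sum_(i < d) x i g *: X i)].

Definition levy_measure (R : realType) (d : nat) (G : lieGroupType R d)
    (expG : lie_algebra G -> G) (X : 'I_d -> lie_algebra G)
    (mu : {measure set (borel G) -> \bar R}) : Prop :=
  mu [set 1%g : G] = 0%E /\
  forall (U : set G) (x : 'I_d -> G -> R),
    canonical_coordinates expG X U x ->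
    (\int[mu]_(g in (U : set (borel G))) ((\sum_(i < d) x i g ^+ 2)%:E)
       < +oo)%E /\
    (mu (~` U) < +oo)%E.

(* C_b(Y), for functions given on all of G and restricted to Y. *)
Definition bounded_continuous_on (R : realType) (d : nat)
    (G : lieGroupType R d) (Y : set G) (h : G -> R) : Prop :=
  {within Y, continuous h} /\
  exists M : R, forall g, Y g -> `|h g| <= M.

Definition linear_on_smooth (R : realType) (d : nat) (G : lieGroupType R d)
    (A : (G -> R) -> G -> R) : Prop :=
  forall (k : R) (f g : G -> R), smooth f -> smooth g ->
    A (fun s => k * f s + g s) = (fun s => k * A f s + A g s).

Definition positive_maximum_principle (R : realType) (d : nat)
    (G : lieGroupType R d) (A : (G -> R) -> G -> R) : Prop :=
  forall (f : G -> R) (rho : G), smooth f ->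
    f rho = sup (range f) -> 0 <= f rho -> A f rho <= 0.

(* An irreducible unitary representation on C^n in an orthonormal basis; the
   continuity of the matrix coefficients is the continuity of p. *)
Definition irreducible_unitary_rep (R : realType) (d : nat)
    (G : lieGroupType R d) (n : nat) (p : G -> 'M[R[i]]_n) : Prop :=
  [/\ (0 < n)%N,
      forall g, p g \is unitarymx,
      forall g h : G, p (g * h)%g = p g *m p h,
      forall i j, continuous (fun g => complex.Re (p g i j) : R) /\
                  continuous (fun g => complex.Im (p g i j) : R) &
      forall W : {vspace 'cV[R[i]]_n},
        (forall g v, v \in W -> p g *m v \in W) -> W = 0%VS \/ W = fullv].

(* The extension of a real functional L to matrix-valued functions: complex
   linearly in each entry. *)
Definition entrywise (R : realType) (T : Type) (L : (T -> R) -> R) (n : nat)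
    (F : T -> 'M[R[i]]_n) : 'M[R[i]]_n :=
  \matrix_(i, j) (L (fun t => complex.Re (F t i j)) +i*
                  L (fun t => complex.Im (F t i j))).

Definition derived_rep (R : realType) (d : nat) (G : lieGroupType R d)
    (expG : lie_algebra G -> G) (n : nat) (p : G -> 'M[R[i]]_n)
    (X : lie_algebra G) : 'M[R[i]]_n :=
  entrywise (fun f : R -> R => derive1 f 0) (fun u : R => p (expG (u *: X))).

Definition symbol (R : realType) (d : nat) (G : lieGroupType R d)
    (A : (G -> R) -> G -> R) (n : nat) (s : G) (p : G -> 'M[R[i]]_n) :
    'M[R[i]]_n :=
  invmx (p s) *m entrywise (fun f : G -> R => A f s) p.

(* Main.v *)
Require Import Defs.
From HB Require Import structures.
From mathcomp Require Import all_boot all_order all_algebra.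
From mathcomp Require Import all_classical all_reals all_analysis.
From mathcomp Require Import complex ring lra measurable_realfun.

Import Order.TTheory GRing.Theory Num.Theory.
Import numFieldNormedType.Exports.

Local Open Scope classical_set_scope.
Local Open Scope ring_scope.
Local Open Scope complex_scope.

Set Implicit Arguments.
Unset Strict Implicit.
Unset Printing Implicit Defensive.

(* Matrix coefficients of a representation are smooth, so [A_form] applies to
   them, and [p (s * t) = p s *m p t] turns every term into [p s] times a term
   of the claimed formula; the integral commutes with [p s] because its
   integrand is integrable, being O(|x|^2) on [U] and bounded off [U].

   Smoothness is proved for the real representation [rho] underlying [p].  Along
   dyadic multiples, [2^k (rho (exp (v / 2^k)) - 1)] converges to a continuous
   homogeneous [L v] with [rho (exp v) = 1 + L v + O(|v|^2)].  For a smooth map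
   [q] into the group, the derivative of [rho (q v)] is therefore
   [rho (q v) * L (omega v)], with [omega] the smooth pullback of the
   Maurer-Cartan form.  Taking for [q] the inverse of the canonical coordinates,
   [rho \o q] is C^1, hence differentiable, which forces [L] to be linear; taking
   for [q] the inverse of a chart, a bootstrap then shows that [rho] is smooth. *)

(** * Calculus of C^k functions *)

(** The hypothesis [is_exponential] gives regularity of [expG] only along each line [u *: X]; joint
    regularity near [0] is available only because the inverse of the canonical coordinates agrees
    there with the exponential. This is why [L] is built ray by ray and comes out continuous and
    homogeneous, with additivity in [v] out of reach at that stage. Those two properties already
    suffice to differentiate [rho] along a curve through the neutral element, and linearity is
    recovered afterwards.

    [Ck] speaks of directional derivatives only, so the chain rule must first recover Frechet
    differentiability from continuous partial derivatives.

    [derive1] and the integral are defined for all real functions but linear only on suitable ones.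
    Complex matrices pass through them by way of real and imaginary parts, and each passage is paid
    for by derivability or integrability of these parts. The remainder bound behind the smoothness
    proof serves a second time there, as the bound of the Levy integrand on [U]. *)

Lemma cvg_sumr (R : realType) (V : normedModType R) (T I : Type)
    (F : set_system T) {FF : Filter F} (r : seq I) (P : pred I)
    (f : I -> T -> V) (l : I -> V) :
  (forall i, P i -> f i t @[t --> F] --> l i) ->
  \sum_(i <- r | P i) f i t @[t --> F] --> \sum_(i <- r | P i) l i.
Proof. by move=> fl; apply: cvg_big => //; exact: add_continuous. Qed.

Lemma mx_entry_le_norm (R : realType) (m n : nat) (M : 'M[R]_(m, n)) i j :
  `|M i j| <= `|M|.
Proof.
rewrite [leRHS]/Num.Def.normr/= mx_normrE.
exact: (le_bigmax _ (fun ij : 'I_m * 'I_n => `|M ij.1 ij.2|) (i, j)).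
Qed.

Lemma mx_norm_le (R : realType) (m n : nat) (M : 'M[R]_(m, n)) (c : R) :
  0 <= c -> (forall i j, `|M i j| <= c) -> `|M| <= c.
Proof.
move=> c0 Mc; rewrite /Num.Def.normr/= mx_normrE.
by rewrite bigmax_le// => -[i j] _ /=.
Qed.

Lemma is_derive_line (R : realType) (V W : normedModType R) (f : V -> W)
    (a v : V) (t : R) (df : W) :
  is_derive (a + t *: v) v f df ->
  is_derive t (1 : R) (fun s : R => f (a + s *: v)) df.
Proof.
have E : (fun h : R => h^-1 *: (((fun s : R => f (a + s *: v)) \o shift t) (h *: 1) -
      f (a + t *: v))) =
    (fun h : R => h^-1 *: ((f \o shift (a + t *: v)) (h *: v) - f (a + t *: v))).
  apply/funext => h /=; congr (_ *: (f _ - _)).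
  by rewrite addrCA scalerDl [h *: 1]mulr1.
by case=> dfa <-; apply: DeriveDef; rewrite /derivable /derive /= E.
Qed.

(** By the mean value theorem [f b - f 0 = df t * b] for an intermediate [t]. The two signs of [b]
    are treated apart because [MVT_segment] wants ordered endpoints; in the application [b] is one
    coordinate of an increment. *)
Lemma mean_value_bound (R : realType) (f df : R -> R) (b c e : R) :
  (forall t, `|t| <= `|b| -> is_derive t (1 : R) f (df t) /\ `|df t - c| <= e) ->
  `|f b - f 0 - b * c| <= e * `|b|.
Proof.
move=> H.
have Hc t : `|t| <= `|b| -> {for t, continuous f}.
  move=> /H[ft _]; apply/differentiable_continuous/derivable1_diffP.
  exact: ex_derive.
have [b0|b0] := leP 0 b.
  have Hb t : t \in `[0, b] -> `|t| <= `|b|.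
    by rewrite in_itv /= => /andP[t0 tb]; rewrite !ger0_norm.
  have [||t tb] := @MVT_segment _ f df 0 b b0.
  - by move=> t tb; have /Hb/H[] : t \in `[0, b] by exact: subset_itv_oo_cc tb.
  - apply: continuous_in_subspaceT => t; rewrite inE /= => tb.
    by apply/Hc/Hb.
  rewrite subr0 => ->; rewrite mulrC -mulrBr normrM mulrC ler_wpM2r//.
  by have [] := H _ (Hb _ tb).
have Hb t : t \in `[b, 0] -> `|t| <= `|b|.
  by rewrite in_itv /= => /andP[t0 tb]; rewrite !ler0_norm ?lerN2 // ltW.
have [||t tb] := @MVT_segment _ f df b 0 (ltW b0).
- by move=> t tb; have /Hb/H[] : t \in `[b, 0] by exact: subset_itv_oo_cc tb.
- apply: continuous_in_subspaceT => t; rewrite inE /= => tb.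
  by apply/Hc/Hb.
rewrite -[f b - f 0]opprB => ->.
rewrite sub0r mulrN opprK -[b * c]mulrC -mulrBl normrM ler_wpM2r//.
by have [] := H _ (Hb _ tb).
Qed.

Lemma differentiable_approx (R : realType) (V W : normedModType R) (f : V -> W)
    (df : {linear V -> W}) (x : V) :
  continuous df ->
  (forall e, 0 < e -> \forall h \near (0 : V),
     `|f (h + x) - (f x + df h)| <= e * `|h|) ->
  differentiable f x.
Proof.
move=> df_cont H.
suff E : f \o shift x = cst (f x) + df +o_ 0 id.
  by apply/diff_locallyP; rewrite (diff_unique df_cont E); split.
by apply/eqaddoP => e /H.
Qed.

(** The increment is split into moves along one axis at a time; the mean value theorem bounds the
    error of each move by the oscillation of one partial derivative. *)
Lemma C1_differentiable (R : realType) (n : nat) (f : 'rV[R]_n -> R)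
    (x : 'rV[R]_n) :
  (\forall y \near x, forall i, derivable f y (delta_mx 0 i)) ->
  (forall i, {for x, continuous (fun y => 'D_(delta_mx 0 i) f y)}) ->
  differentiable f x.
Proof.
move=> derf contf.
pose df (h : 'rV[R]_n) := \sum_(i < n) h 0 i * 'D_(delta_mx 0 i) f x.
have df_lin : linear df.
  move=> k u v; rewrite /df scaler_sumr -big_split /=; apply: eq_bigr => i _.
  by rewrite !mxE mulrDl scalerAl.
pose dfB := GRing.isLinear.Build _ _ _ _ _ df_lin.
pose dfL : {linear 'rV[R]_n -> R} := HB.pack df dfB.
have df_cont : continuous dfL.
  move=> u; apply: (@cvg_sumr R R _ _ (nbhs u) (nbhs_filter u)) => i _.
  by apply: cvgMr_tmp; exact: coord_continuous.
apply: (differentiable_approx df_cont) => e e0.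
(* Each of the [n] moves may cost [e / n.+1] times the norm of [h]; the successor keeps the
   denominator nonzero when [n = 0]. *)
have n0 : 0 < (n.+1)%:R :> R by rewrite ltr0n.
have : \forall y \near x, forall i, derivable f y (delta_mx 0 i) /\
    `|'D_(delta_mx 0 i) f y - 'D_(delta_mx 0 i) f x| <= e / n.+1%:R.
  have : \forall y \near x, forall i,
      `|'D_(delta_mx 0 i) f y - 'D_(delta_mx 0 i) f x| <= e / n.+1%:R.
    apply: (@filter_forall _ _ _ _ (nbhs_filter x)) => i.
    have /cvgrPdist_le/(_ (e / n.+1%:R)) := contf i.
    rewrite divr_gt0// => /(_ isT); apply: filterS => y.
    by rewrite distrC.
  by apply: filterS2 derf => y H1 H2 i; split.
move=> /nbhs_ballP[r /= r0 Hr].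
apply/nbhs_ballP; exists r => //= h.
rewrite -ball_normE /= sub0r normrN => hr.
rewrite /= /df.
(* [hk k] keeps the first [k] coordinates of [h], so the sum telescopes from [x] to [x + h]. *)
pose hk k : 'rV[R]_n := \row_j (if (j < k)%N then h 0 j else 0).
have -> : f (h + x) - (f x + \sum_(i < n) h 0 i * 'D_(delta_mx 0 i) f x) =
  \sum_(i < n) (f (x + hk i.+1) - f (x + hk i) - h 0 i * 'D_(delta_mx 0 i) f x).
  rewrite [RHS]sumrB opprD addrA; congr (_ - _).
  rewrite -(big_mkord xpredT (fun i => f (x + hk i.+1) - f (x + hk i))).
  rewrite telescope_sumr//; congr (f _ - f _).
    by rewrite addrC; congr (_ + _); apply/rowP => j; rewrite mxE ltn_ord.
  rewrite [hk 0%N](_ : _ = 0) ?addr0//.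
  by apply/rowP => j; rewrite !mxE.
apply: (@le_trans _ _ (\sum_(i < n) (e / n.+1%:R * `|h|))).
  apply: le_trans (ler_norm_sum _ _ _) _; apply: ler_sum => i _.
  have -> : x + hk i.+1 = x + hk i + h 0 i *: delta_mx 0 i.
    rewrite -addrA; congr (_ + _); apply/rowP => j; rewrite !mxE ltnS.
    rewrite leq_eqVlt [val j == val i]val_eqE.
    have [->|ji] := eqVneq j i; first by rewrite ltnn eqxx mulr1 add0r.
    by rewrite andbF mulr0 addr0.
  apply: (@le_trans _ _ (e / n.+1%:R * `|h 0 i|)); last first.
    by rewrite ler_wpM2l ?mx_entry_le_norm// divr_ge0 ?ltW.
  have := @mean_value_bound _ (fun t => f (x + hk i + t *: delta_mx 0 i))
    (fun t => 'D_(delta_mx 0 i) f (x + hk i + t *: delta_mx 0 i))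
    (h 0 i) ('D_(delta_mx 0 i) f x) (e / n.+1%:R).
  rewrite scale0r addr0; apply => t th.
  (* In the max norm a partial move is no longer than [h], so it stays in the ball. *)
  have : ball x r (x + hk i + t *: delta_mx 0 i).
    rewrite -ball_normE /= -addrA opprD addrA subrr sub0r normrN.
    apply: le_lt_trans hr; apply: mx_norm_le => // i0 j; rewrite !mxE (ord1 i0) /=.
    have [->|ji] := eqVneq j i.
      by rewrite ltnn mulr1 add0r (le_trans th)// mx_entry_le_norm.
    rewrite mulr0 addr0; case: ifP => _; first exact: mx_entry_le_norm.
    by rewrite normr0.
  move=> /Hr/(_ i)[D1 D2]; split => //.
  by apply: is_derive_line; apply/derivableP.
rewrite sumr_const card_ord -[leLHS]mulr_natr mulrAC ler_wpM2r//.
by rewrite mulrAC ler_pdivrMr// ler_wpM2l ?ler_nat// ltW.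
Qed.

Lemma is_derive_along (R : realType) (V W : normedModType R) (f : V -> W)
    (x v : V) (df : W) :
  is_derive (0 : R) (1 : R) (fun h : R => f (h *: v + x)) df <->
  is_derive x v f df.
Proof.
have E : (fun h : R => h^-1 *: (((fun h : R => f (h *: v + x)) \o shift 0) (h *: 1) -
      f (0 *: v + x))) =
    (fun h : R => h^-1 *: ((f \o shift x) (h *: v) - f x)).
  apply/funext => h /=; rewrite scale0r add0r addr0.
  by rewrite [h *: 1]mulr1.
by split=> -[d1 d2]; apply: DeriveDef; move: d1 d2;
  rewrite /derivable /derive /= E.
Qed.

(** [g] is only assumed derivable in the direction [v]. Restricted to the line through [z] it
    becomes a curve [gam] of one real variable, where derivable and differentiable coincide, and the
    chain rule for differentials applies. *)
Lemma is_derive_comp_rV (R : realType) (U : normedModType R) (n : nat)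
    (f : 'rV[R]_n -> R) (g : U -> 'rV[R]_n) (z v : U) :
  differentiable f (g z) -> (forall i, derivable (fun y => g y 0 i : R) z v) ->
  is_derive z v (f \o g)
    (\sum_(i < n) 'D_v (fun y => g y 0 i) z * 'D_(delta_mx 0 i) f (g z)).
Proof.
move=> df dg.
have dgz : derivable g z v by apply/derivable_mxP => i j; rewrite (ord1 i).
have /is_derive_along[gam_der gam_val] := derivableP dgz.
set gam := fun h : R => _ in gam_der gam_val.
have gam_diff : differentiable gam 0 by apply/derivable1_diffP.
have gam0 : gam 0 = g z by rewrite /gam scale0r add0r.
have dfg : differentiable f (gam 0) by rewrite gam0.
apply/is_derive_along; apply: DeriveDef.
  exact/derivable1_diffP/(differentiable_comp gam_diff dfg).
have := deriveE (1 : R) (differentiable_comp gam_diff dfg).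
rewrite diff_comp//= -(deriveE _ gam_diff) gam_val gam0 => ->.
rewrite {1}(row_sum_delta ('D_v g z)) linear_sum /=; apply: eq_bigr => i _.
have -> : 'D_v g z 0 i = 'D_v (fun y => g y 0 i : R) z by rewrite (derive_mx dgz) mxE.
rewrite (deriveE _ df).
exact: (linearZ_LR ('d f (g z))).
Qed.

Lemma cvg_mx_entries (R : realType) (T : Type) (F : set_system T)
    {FF : Filter F} (m n : nat) (f : T -> 'M[R]_(m, n)) (l : 'M[R]_(m, n)) :
  (forall i j, f t i j @[t --> F] --> l i j) -> f t @[t --> F] --> l.
Proof.
move=> fl; apply/cvgrPdist_le => e e0.
have : \forall t \near F, forall ij : 'I_m * 'I_n,
    `|l ij.1 ij.2 - f t ij.1 ij.2| <= e.
  apply: filter_forall => ij.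
  by have /cvgrPdist_le/(_ _ e0) := fl ij.1 ij.2.
apply: filterS => t Ht; apply: mx_norm_le (ltW e0) _ => i j.
by rewrite !mxE; exact: (Ht (i, j)).
Qed.

Section Ck_basic.
Variables (R : realType) (V : normedModType R).

Lemma Ck_continuous (W : normedModType R) (k : nat) (O : set V) (f : V -> W) :
  Ck k O f -> forall x, O x -> {for x, continuous f}.
Proof. by case: k => [|k] []. Qed.

Lemma Ck_derivable (W : normedModType R) (k : nat) (O : set V) (f : V -> W) :
  Ck k.+1 O f -> forall x v, O x -> derivable f x v.
Proof. by move=> [_ H] x v Ox; have [d _] := H v; exact: d. Qed.

Lemma Ck_derive (W : normedModType R) (k : nat) (O : set V) (f : V -> W) v :
  Ck k.+1 O f -> Ck k O (fun x => 'D_v f x).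
Proof. by move=> [_ /(_ v)[]]. Qed.

(** The conditions in [Ck] are imposed point by point, with limits taken in the ambient space, so
    any set [N] containing the point will do. *)
Lemma Ck_local (W : normedModType R) (k : nat) (O : set V) (f : V -> W) :
  (forall x, O x -> exists2 N, N x & Ck k N f) -> Ck k O f.
Proof.
elim: k f => [|k IH] f H.
  by split=> // x /H[N Nx /Ck_continuous]; apply.
split=> [x /H[N Nx /Ck_continuous]|v]; first by apply.
split=> [x /H[N Nx /Ck_derivable]|]; first by apply.
by apply: IH => x /H[N Nx /(Ck_derive v)]; exists N.
Qed.

Lemma Ck_sub (W : normedModType R) (k : nat) (O N : set V) (f : V -> W) :
  N `<=` O -> Ck k O f -> Ck k N f.
Proof. by move=> NO Of; apply: Ck_local => x /NO; exists O. Qed.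

Lemma CkW (W : normedModType R) (k : nat) (O : set V) (f : V -> W) :
  Ck k.+1 O f -> Ck k O f.
Proof.
elim: k f => [|k IH] f [c H]; first by split.
by split=> // v; have [d1 d2] := H v; split => //; exact: IH.
Qed.

End Ck_basic.

Section Ck_calculus.
Variables (R : realType) (V : normedModType R) (O : set V).
Hypothesis openO : open O.

(** Derivatives at a point agree once the functions agree near it: this is where the openness of [O]
    enters the calculus. *)
Lemma Ck_ext (W : normedModType R) (k : nat) (f g : V -> W) :
  (forall x, O x -> f x = g x) -> Ck k O f -> Ck k O g.
Proof.
have nfg f' g' : (forall x, O x -> f' x = g' x) -> forall x, O x ->
    \forall y \near x, f' y = g' y :> W.
  move=> fg x Ox; have : nbhs x O by exact: open_nbhs_nbhs.
  exact: filterS.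
have cont f' g' : (forall x, O x -> f' x = g' x) ->
    (forall x, O x -> {for x, continuous (f' : V -> W)}) ->
    forall x, O x -> {for x, continuous (g' : V -> W)}.
  move=> fg cf x Ox; rewrite /prop_for /continuous_at -fg//.
  by apply: cvg_trans (cf _ Ox); apply: near_eq_cvg; exact: nfg.
elim: k f g => [|k IH] f g fg [cf df]; first by split=> //; exact: cont cf.
split; first exact: cont cf.
move=> v; have [d1 d2] := df v; split=> [x Ox|].
  by apply: (near_eq_derivable (nfg _ _ fg _ Ox)); exact: d1.
apply: IH d2 => x Ox; exact/near_eq_derive/(nfg _ _ fg).
Qed.

Lemma Ck_cst (W : normedModType R) (k : nat) (a : W) : Ck k O (fun=> a).
Proof.
elim: k a => [|k IH] a; first by split => // x _; exact: cvg_cst.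
split=> [x _|v]; first exact: cvg_cst.
split=> [x _|]; first exact: derivable_cst.
by apply: Ck_ext (IH 0) => x _; rewrite derive_cst.
Qed.

Lemma Ck_add (W : normedModType R) (k : nat) (f g : V -> W) :
  Ck k O f -> Ck k O g -> Ck k O (fun x => f x + g x).
Proof.
elim: k f g => [|k IH] f g [cf df] [cg dg].
  by split=> // x Ox; apply: cvgD; [exact: cf|exact: cg].
split=> [x Ox|v]; first by apply: cvgD; [exact: cf|exact: cg].
have [d1 d2] := df v; have [d3 d4] := dg v.
split=> [x Ox|]; first by apply: derivableD; [exact: d1|exact: d3].
apply: Ck_ext (IH _ _ d2 d4) => x Ox.
by rewrite [RHS]deriveD//; [exact: d1|exact: d3].
Qed.

Lemma Ck_mul (k : nat) (f g : V -> R) :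
  Ck k O f -> Ck k O g -> Ck k O (fun x => f x * g x).
Proof.
elim: k f g => [|k IH] f g [cf df] [cg dg].
  by split=> // x Ox; apply: cvgM; [exact: cf|exact: cg].
split=> [x Ox|v]; first by apply: cvgM; [exact: cf|exact: cg].
have [d1 d2] := df v; have [d3 d4] := dg v.
split=> [x Ox|]; first by apply: derivableM; [exact: d1|exact: d3].
apply: Ck_ext (Ck_add (IH _ _ (CkW (conj cf df : Ck k.+1 O f)) d4)
                      (IH _ _ (CkW (conj cg dg : Ck k.+1 O g)) d2)) => x Ox.
by rewrite [RHS]deriveM//; [exact: d1|exact: d3].
Qed.

Lemma Ck_sum (W : normedModType R) (I : Type) (k : nat) (r : seq I)
    (f : I -> V -> W) :
  (forall i, Ck k O (f i)) -> Ck k O (fun x => \sum_(i <- r) f i x).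
Proof.
move=> fk; elim: r => [|i r IH].
  by apply: Ck_ext (Ck_cst k 0) => x _; rewrite big_nil.
by apply: Ck_ext (Ck_add (fk i) IH) => x _; rewrite big_cons.
Qed.

Lemma Ck_entry (n : nat) (k : nat) (f : V -> 'rV[R]_n) (i : 'I_n) :
  Ck k O f -> Ck k O (fun x => f x 0 i : R).
Proof.
have cont (f' : V -> 'rV[R]_n) x :
    {for x, continuous f'} -> {for x, continuous (fun x => f' x 0 i : R)}.
  move=> cf.
  apply: (@cvg_comp _ _ _ f' (fun M : 'rV[R]_n => M 0 i) _ (nbhs (f' x))) => //.
  exact: coord_continuous.
elim: k f => [|k IH] f [cf df]; first by split=> // x /cf/cont.
split=> [x /cf/cont//|v]; have [d1 d2] := df v.
split=> [x /d1/derivable_mxP//|].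
apply: Ck_ext (IH _ d2) => x /d1 dx.
by rewrite derive_mx// mxE.
Qed.

(** Induction on [k] for all [f]: the chain rule writes a derivative of the composite as a sum of
    products of derivatives of [g] with partial derivatives of [f] composed with [g], to which the
    induction hypothesis applies. [f] is differentiable because its partial derivatives are
    continuous on the open set [Of]. *)
Lemma Ck_comp (n k : nat) (Of : set 'rV[R]_n) (f : 'rV[R]_n -> R)
    (g : V -> 'rV[R]_n) :
  open Of -> Ck k Of f -> (forall i, Ck k O (fun x => g x 0 i : R)) ->
  (forall x, O x -> Of (g x)) -> Ck k O (fun x => f (g x)).
Proof.
move=> openOf.
have cont (f' : 'rV[R]_n -> R) x :
    (forall i j, {for x, continuous (fun y => g y i j : R)}) ->
    {for g x, continuous f'} -> {for x, continuous (fun y => f' (g y))}.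
  move=> cg cf; apply: (@cvg_comp _ _ _ g f' _ (nbhs (g x))) => //.
  exact: cvg_mx_entries.
elim: k f => [|k IH] f kf kg gO.
  split => // x Ox; apply: cont => [i j|]; last exact (Ck_continuous kf (gO _ Ox)).
  by rewrite (ord1 i); exact (Ck_continuous (kg j) Ox).
have dcomp x v : O x -> is_derive x v (f \o g)
    (\sum_(i < n) 'D_v (fun y => g y 0 i) x * 'D_(delta_mx 0 i) f (g x)).
  move=> Ox; apply: is_derive_comp_rV => [|i]; last exact (Ck_derivable (kg i) Ox).
  apply: C1_differentiable => [|i].
    have : nbhs (g x) Of by apply: open_nbhs_nbhs; split => //; exact: gO.
    by apply: filterS => y Oy i; exact (Ck_derivable kf Oy).
  exact (Ck_continuous (Ck_derive _ kf) (gO _ Ox)).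
split=> [x Ox|v].
  apply: cont => [i j|]; last exact (Ck_continuous kf (gO _ Ox)).
  by rewrite (ord1 i); exact (Ck_continuous (kg j) Ox).
split=> [x Ox|]; first by case: (dcomp x v Ox).
have sumk : Ck k O (fun x =>
    \sum_(i < n) 'D_v (fun y => g y 0 i) x * 'D_(delta_mx 0 i) f (g x)).
  apply: Ck_sum => i; apply: (Ck_mul (Ck_derive v (kg i))).
  exact: (IH _ (Ck_derive _ kf) (fun j => CkW (kg j)) gO).
by apply: Ck_ext sumk => x Ox; case: (dcomp x v Ox) => _ <-.
Qed.

End Ck_calculus.

(** The difference quotient of [f \o l] along [v] is literally that of [f] along [l v], so no chain
    rule is involved and [V] may be a product space, which [Ck_comp] does not allow. It serves for
    projections, the diagonal and the splitting of a row vector. *)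
Lemma Ck_precomp_linear (R : realType) (U V W : normedModType R) (k : nat)
    (O : set V) (f : V -> W) (l : U -> V) :
  (forall (h : R) u v, l (h *: u + v) = h *: l u + l v) -> continuous l ->
  Ck k O f -> Ck k (l @^-1` O) (fun u => f (l u)).
Proof.
move=> ll lc.
have cont (f' : V -> W) (x : U) :
    {for l x, continuous f'} -> {for x, continuous (fun u => f' (l u))}.
  by move=> cf; exact: (@cvg_comp _ _ _ l f' _ (nbhs (l x)) _ (lc x) cf).
have E (f' : V -> W) x v :
    (fun h : R => h^-1 *: (((fun u => f' (l u)) \o shift x) (h *: v) - f' (l x))) =
    (fun h : R => h^-1 *: ((f' \o shift (l x)) (h *: l v) - f' (l x))).
  by apply/funext => h /=; rewrite ll.
elim: k f => [|k IH] f [cf df]; first by split=> // x /cf/cont.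
split=> [x /cf/cont//|v]; have [d1 d2] := df (l v).
split=> [x /d1|]; first by rewrite /derivable E.
rewrite (_ : (fun x => _) = (fun u => 'D_(l v) f (l u))); first exact (IH _ d2).
by apply/funext => x; rewrite /derive E.
Qed.

(** * Smooth maps into a Lie group *)

Lemma open_setX (T S : topologicalType) (A : set T) (B : set S) :
  open A -> open B -> open (A `*` B).
Proof.
move=> oA oB; rewrite openE => -[x y] [/= Ax By]; exists (A, B) => //=.
by split; exact: open_nbhs_nbhs.
Qed.

Lemma continuous_pair (T S1 S2 : topologicalType) (f : T -> S1) (g : T -> S2)
    (x : T) :
  {for x, continuous f} -> {for x, continuous g} ->
  {for x, continuous (fun y => (f y, g y))}.
Proof. by move=> cf cg; exact (cvg_pair cf cg). Qed.

Lemma continuous_at_comp (T S1 S2 : topologicalType) (f : T -> S1)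
    (g : S1 -> S2) (x : T) :
  {for x, continuous f} -> {for f x, continuous g} ->
  {for x, continuous (fun y => g (f y))}.
Proof. by move=> cf cg; exact (continuous_comp cf cg). Qed.

Lemma open_setI_preimage (T S : topologicalType) (O : set T) (p : T -> S)
    (D : set S) :
  open O -> (forall x, O x -> {for x, continuous p}) -> open D ->
  open (O `&` p @^-1` D).
Proof.
move=> openO cp openD; rewrite openE => x [Ox Dpx]; apply: filterI.
  exact: open_nbhs_nbhs.
by apply: (cp _ Ox); exact: open_nbhs_nbhs.
Qed.

Section manifold.
Variables (R : realType) (d : nat) (G : lieGroupType R d).

Lemma chart_at (g : G) : exists2 c, atlas G c & chart_dom c g.
Proof. exact: lie_atlas_cover. Qed.

Lemma smooth_continuous (f : G -> R) : smooth f -> continuous f.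
Proof.
move=> sf g; have [c ac cg] := chart_at g.
have domg : nbhs g (chart_dom c).
  by apply: open_nbhs_nbhs; split => //; exact: chart_dom_open.
have cf := Ck_continuous (sf c ac 0) (chart_funP cg).
have := continuous_at_comp (chart_fun_continuous cg) cf.
rewrite /prop_for /continuous_at /= chart_funK//; apply: cvg_trans; apply: near_eq_cvg.
by apply: filterS domg => h ch /=; rewrite chart_funK.
Qed.

Lemma lie_mul_continuous (g h : G) :
  {for (g, h), continuous (fun a : G * G => (a.1 * a.2)%g)}.
Proof.
have [c1 ac1 c1g] := chart_at g; have [c2 ac2 c2h] := chart_at h.
have dom1 : nbhs g (chart_dom c1).
  by apply: open_nbhs_nbhs; split => //; exact: chart_dom_open.
have dom2 : nbhs h (chart_dom c2).
  by apply: open_nbhs_nbhs; split => //; exact: chart_dom_open.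
have [cm _] := lie_mul_smooth c1 c2 ac1 ac2.
have /= := cm (chart_fun c1 g, chart_fun c2 h) (conj (chart_funP c1g) (chart_funP c2h)).
move=> cm'.
have cp : {for (g, h), continuous
    (fun a : G * G => (chart_fun c1 a.1, chart_fun c2 a.2))}.
  have fstc : {for (g, h), continuous (fun a : G * G => a.1)} by exact: cvg_fst.
  have sndc : {for (g, h), continuous (fun a : G * G => a.2)} by exact: cvg_snd.
  apply: continuous_pair.
    exact (continuous_at_comp fstc (chart_fun_continuous c1g)).
  exact (continuous_at_comp sndc (chart_fun_continuous c2h)).
have := continuous_at_comp cp cm'.
rewrite /prop_for /continuous_at /= !chart_funK// => H.
apply: cvg_trans H; apply: near_eq_cvg.
exists (chart_dom c1, chart_dom c2) => //= -[x y] /= [xc yc].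
by rewrite !chart_funK.
Qed.

Lemma lie_inv_continuous : continuous (fun g : G => g^-1%g).
Proof.
move=> g; have [c ac cg] := chart_at g.
have domg : nbhs g (chart_dom c).
  by apply: open_nbhs_nbhs; split => //; exact: chart_dom_open.
have [ci _] := lie_inv_smooth c ac.
have := continuous_at_comp (chart_fun_continuous cg) (ci _ (chart_funP cg)).
rewrite /prop_for /continuous_at /= chart_funK//; apply: cvg_trans; apply: near_eq_cvg.
by apply: filterS domg => h ch /=; rewrite chart_funK.
Qed.

(** [smooth_into] read coordinate by coordinate: real-valued components are what [Ck_comp] and
    [Ck_mul] take. *)
Definition smooth_map (V : normedModType R) (O : set V) (p : V -> G) : Prop :=
  (forall v, O v -> {for v, continuous p}) /\
  forall c, atlas G c -> forall k i,
    Ck k (O `&` p @^-1` chart_dom c) (fun v => chart_fun c (p v) 0 i : R).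

Lemma smooth_into_map (V : normedModType R) (O : set V) (p : V -> G) :
  open O -> smooth_into (atlas G) O p -> smooth_map O p.
Proof.
move=> openO [cp sp]; split=> // c ac k i.
apply: Ck_entry (sp c ac k).
by apply: open_setI_preimage => //; exact: chart_dom_open.
Qed.

Lemma smooth_map_chart_inv (c : chart R d G) :
  atlas G c -> smooth_map (chart_im c) (chart_inv c).
Proof.
move=> ac; apply: smooth_into_map; first exact: chart_im_open.
exact: lie_atlas_compatible.
Qed.

Section maps.
Variables (V : normedModType R) (O : set V).
Hypothesis openO : open O.

Let open_dom (p : V -> G) (c : chart R d G) :
  smooth_map O p -> open (O `&` p @^-1` chart_dom c).
Proof. by move=> [cp _]; apply: open_setI_preimage => //; exact: chart_dom_open. Qed.

Lemma smooth_comp_map (f : G -> R) (p : V -> G) (k : nat) :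
  smooth f -> smooth_map O p -> Ck k O (fun v => f (p v)).
Proof.
move=> sf mp; apply: Ck_local => v Ov.
have [c ac cpv] := chart_at (p v).
exists (O `&` p @^-1` chart_dom c) => //.
have oN := open_dom c mp.
have : Ck k (O `&` p @^-1` chart_dom c)
    (fun v => f (chart_inv c (chart_fun c (p v)))).
  apply: (Ck_comp oN (@chart_im_open _ _ _ c) (sf c ac k)).
    by move=> i; have [_ H] := mp; exact: H.
  by move=> w [_]; exact: chart_funP.
by apply: Ck_ext => // w [_ cw]; rewrite chart_funK.
Qed.

Lemma smooth_map_mul (p q : V -> G) :
  smooth_map O p -> smooth_map O q -> smooth_map O (fun v => (p v * q v)%g).
Proof.
move=> mp mq.
have cpq v : O v -> {for v, continuous (fun v => (p v * q v)%g)}.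
  move=> Ov; have [cp _] := mp; have [cq _] := mq.
  exact (continuous_at_comp (continuous_pair (cp v Ov) (cq v Ov))
    (@lie_mul_continuous _ _)).
split=> // c ac k i; apply: Ck_local => v [Ov cv].
have [c1 ac1 c1v] := chart_at (p v); have [c2 ac2 c2v] := chart_at (q v).
pose N := (O `&` p @^-1` chart_dom c1) `&` (O `&` q @^-1` chart_dom c2) `&`
  (O `&` (fun v => (p v * q v)%g) @^-1` chart_dom c).
have oN : open N.
  apply: openI; first by apply: openI; exact: open_dom.
  by apply: open_setI_preimage => //; exact: chart_dom_open.
exists N => //.
(* [lie_mul_smooth] lives on pairs, while [Ck_comp] composes through row vectors; [l] identifies
   ['rV_(d + d)] with the pairs. *)
pose l (w : 'rV[R]_(d + d)) : 'rV[R]_d * 'rV[R]_d := (lsubmx w, rsubmx w).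
have lc : continuous l.
  move=> w; apply: continuous_pair; first exact: continuous_lsubmx.
  exact: continuous_rsubmx.
pose m (v : 'rV[R]_d * 'rV[R]_d) := (chart_inv c1 v.1 * chart_inv c2 v.2)%g.
pose Om := (chart_im c1 `*` chart_im c2) `&` m @^-1` chart_dom c.
have [cm sm] := lie_mul_smooth c1 c2 ac1 ac2.
have oim : open (chart_im c1 `*` chart_im c2).
  by apply: open_setX; exact: chart_im_open.
have oOm : open Om.
  by apply: open_setI_preimage => //; exact: chart_dom_open.
have kF : Ck k (l @^-1` Om) (fun w => chart_fun c (m (l w)) 0 i : R).
  apply: (Ck_precomp_linear (f := fun v => chart_fun c (m v) 0 i : R)) => //.
    by move=> h u w; rewrite /l !linearP.
  by apply: Ck_entry => //; exact: (sm c ac k).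
have : Ck k N (fun v => (fun w => chart_fun c (m (l w)) 0 i : R)
    (row_mx (chart_fun c1 (p v)) (chart_fun c2 (q v)))).
  apply: (Ck_comp oN _ kF).
  - by move/continuousP: lc; apply.
  - move=> j; rewrite (_ : (fun x => _) = fun x : V => match fintype.split j with
      | inl j1 => chart_fun c1 (p x) 0 j1 | inr j2 => chart_fun c2 (q x) 0 j2 end).
      case: (fintype.split j) => j'.
        by apply: Ck_sub (proj2 mp c1 ac1 k j') => x [[]].
      by apply: Ck_sub (proj2 mq c2 ac2 k j') => x [[]].
    by apply/funext => x; rewrite mxE; case: fintype.split.
  - move=> x [[[_ x1] [_ x2]] [_ x3]].
    rewrite /l /Om /preimage /= row_mxKl row_mxKr.
    split; first by split; exact: chart_funP.
    by rewrite /m /= !chart_funK.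
apply: Ck_ext => // x [[[_ x1] [_ x2]] [_ x3]].
by rewrite /l /m /= row_mxKl row_mxKr !chart_funK.
Qed.

Lemma smooth_map_inv (p : V -> G) :
  smooth_map O p -> smooth_map O (fun v => (p v)^-1%g).
Proof.
move=> mp.
have cpi v : O v -> {for v, continuous (fun v => (p v)^-1%g)}.
  move=> Ov; have [cp _] := mp.
  exact (continuous_at_comp (cp v Ov) (@lie_inv_continuous _)).
split=> // c ac k i; apply: Ck_local => v [Ov cv].
have [c1 ac1 c1v] := chart_at (p v).
pose N := (O `&` p @^-1` chart_dom c1) `&`
  (O `&` (fun v => (p v)^-1%g) @^-1` chart_dom c).
have oN : open N.
  apply: openI; first exact: open_dom.
  by apply: open_setI_preimage => //; exact: chart_dom_open.
exists N => //.
pose m (v : 'rV[R]_d) := ((chart_inv c1 v)^-1)%g.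
pose Om := chart_im c1 `&` m @^-1` chart_dom c.
have [cm sm] := lie_inv_smooth c1 ac1.
have oOm : open Om.
  by apply: open_setI_preimage => //; [exact: chart_im_open|exact: chart_dom_open].
have kF : Ck k Om (fun w => chart_fun c (m w) 0 i : R).
  by apply: Ck_entry => //; exact: (sm c ac k).
have : Ck k N (fun v => (fun w => chart_fun c (m w) 0 i : R) (chart_fun c1 (p v))).
  apply: (Ck_comp oN oOm kF).
    by move=> j; apply: Ck_sub (proj2 mp c1 ac1 k j) => x [[]].
  move=> x [[_ x1] [_ x2]]; split; first exact: chart_funP.
  by rewrite /m /= !chart_funK.
apply: Ck_ext => // x [[_ x1] [_ x2]].
by rewrite /m /= !chart_funK.
Qed.

End maps.

Lemma smooth_map_precomp_linear (U V : normedModType R) (O : set V) (p : V -> G)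
    (l : U -> V) :
  (forall (h : R) u v, l (h *: u + v) = h *: l u + l v) -> continuous l ->
  smooth_map O p -> smooth_map (l @^-1` O) (fun u => p (l u)).
Proof.
move=> ll lc [cp sp]; split=> [u Ou|c ac k i].
  exact (continuous_at_comp (lc u) (cp _ Ou)).
exact: (Ck_precomp_linear ll lc (sp c ac k i)).
Qed.

End manifold.

(** * One-parameter groups of matrices *)

(** For the max norm the natural factor is [n]; [n.+1] is positive in every size, so that one may
    divide by it. *)
Lemma mulmx_norm_le (R : realType) (m n p : nat) (A : 'M[R]_(m, n))
    (B : 'M[R]_(n, p)) : `|A *m B| <= n.+1%:R * `|A| * `|B|.
Proof.
have n0 : 0 <= n.+1%:R * `|A| * `|B| by rewrite !mulr_ge0.
apply: mx_norm_le => // i j; rewrite mxE.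
apply: le_trans (ler_norm_sum _ _ _) _.
apply: (@le_trans _ _ (\sum_(k < n) `|A| * `|B|)).
  by apply: ler_sum => k _; rewrite normrM ler_pM ?mx_entry_le_norm.
rewrite sumr_const card_ord -[leLHS]mulr_natl -mulrA ler_wpM2r ?mulr_ge0//.
by rewrite ler_nat.
Qed.

Section dyadic.
Variable R : realType.
Local Notation h k := ((2^-1 : R) ^+ k).

Lemma dyadic_gt0 k : 0 < h k.
Proof. by rewrite exprn_gt0. Qed.

Lemma dyadic_le1 k : h k <= 1.
Proof. by rewrite exprn_ile1// invf_le1// ler1n. Qed.

Lemma dyadic_small (e : R) : 0 < e -> exists k, h k <= e.
Proof.
move=> e0; exists (Num.trunc (e^-1)).+1.
rewrite exprVn -[leRHS]invrK lef_pV2 ?posrE ?exprn_gt0 ?invr_gt0//.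
have : e^-1 < (Num.trunc e^-1).+1%:R by exact: truncnS_gt.
move=> /ltW/le_trans; apply.
by rewrite -natrX ler_nat ltnW// ltn_expl.
Qed.

Lemma dyadic_le0 (x c : R) : (forall k, x <= c * h k) -> x <= 0.
Proof.
move=> H; have [//|x0] := leP x 0.
have c0 : 0 < c by have := H 0%N; rewrite mulr1; exact: lt_le_trans.
have [k hk] := @dyadic_small (x / c / 2) ltac:(by rewrite !divr_gt0).
have := le_trans (H k) (ler_wpM2l (ltW c0) hk).
by rewrite mulrA [c * _]mulrC divfK ?gt_eqF// => xx; lra.
Qed.

Lemma geometric_cauchy (m n : nat) (u : nat -> 'M[R]_(m, n)) (c : R) :
  (forall k, `|u k.+1 - u k| <= c * h k) ->
  cvg (u @ \oo) /\ forall k, `|lim (u @ \oo) - u k| <= 2 * c * h k.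
Proof.
move=> H.
have c0 : 0 <= c by have := H 0%N; rewrite mulr1; exact: le_trans.
have B k l : `|u (k + l)%N - u k| <= 2 * c * h k.
  (* The exact value of the geometric sum is a bound that induction on [l] can carry; [2 * c * h k]
     alone is not. *)
  suff : `|u (k + l)%N - u k| <= 2 * c * (h k - h (k + l)%N).
    move/le_trans; apply; rewrite ler_wpM2l ?mulr_ge0//.
    by rewrite gerBl ltW ?dyadic_gt0.
  elim: l => [|l IH]; first by rewrite addn0 !subrr normr0 mulr0.
  rewrite addnS -(subrKA (u (k + l)%N)); apply: le_trans (ler_normD _ _) _.
  apply: le_trans (lerD (H _) IH) _.
  by rewrite exprS; lra.
have ucvg : cvg (u @ \oo).
  apply/cauchy_cvgP/cauchyP => e e0.
  have c20 : 0 < 2 * c + 1 by lra.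
  have [k hk] := dyadic_small (divr_gt0 e0 c20).
  exists (u k); exists k => //= l kl; rewrite -ball_normE /= distrC -(subnKC kl).
  apply: le_lt_trans (B _ _) _.
  have := dyadic_gt0 k; move: hk; rewrite ler_pdivlMr// => hk k0.
  by apply: lt_le_trans hk; rewrite mulrC; nra.
split=> // k.
have uk : `|u l - u k| @[l --> \oo] --> `|lim (u @ \oo) - u k|.
  by apply: cvg_norm; apply: cvgB => //; exact: cvg_cst.
rewrite -(cvg_lim _ uk)//; apply: limr_le; first exact: cvgP uk.
by exists k => //= l kl; rewrite -(subnKC kl).
Qed.

(** The defect [e s = f s - s *: f 1] is additive and vanishes on the integers, hence is bounded by
    a bound on [[0, 1]]; since [e (2^k t) = 2^k e t], it is zero. *)
Lemma additive_homogeneous (W : normedModType R) (f : R -> W) (c : R) :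
  (forall s t, f (s + t) = f s + f t) -> (forall t, `|f t| <= c * `|t|) ->
  forall t, f t = t *: f 1.
Proof.
move=> fD fb t.
have f0 : f 0 = 0 by apply/eqP; rewrite -normr_le0 (le_trans (fb 0))// normr0 mulr0.
pose e s := f s - s *: f 1.
have eD s s' : e (s + s') = e s + e s'.
  by rewrite /e fD scalerDl opprD addrACA.
have e0 : e 0 = 0 by rewrite /e f0 scale0r subrr.
have en s n : e (n%:R * s) = n%:R *: e s.
  elim: n => [|n IH]; first by rewrite mul0r e0 scale0r.
  by rewrite -addn1 natrD mulrDl mul1r eD IH scalerDl scale1r.
have eN s : e (- s) = - e s.
  by apply/eqP; rewrite -addr_eq0 -eD addNr e0.
have e1 : e 1 = 0 by rewrite /e scale1r subrr.
have ez (z : int) : e z%:~R = 0.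
  case: z => n; first by rewrite -pmulrn -[n%:R]mulr1 en e1 scaler0.
  by rewrite NegzE mulrNz -pmulrn eN -[n.+1%:R]mulr1 en e1 scaler0 oppr0.
have eb s : `|e s| <= c + `|f 1|.
  rewrite -[s](subrK (Num.floor s)%:~R) eD ez addr0.
  have /andP[fl1 fl2] := floor_itv s.
  have s0 : 0 <= s - (Num.floor s)%:~R by rewrite subr_ge0.
  have s1 : s - (Num.floor s)%:~R <= 1.
    by rewrite lerBlDl ltW// -intrD1.
  set x := _ - _ in s0 s1 *.
  rewrite /e; apply: le_trans (ler_normB _ _) _; apply: lerD.
    have := fb x; rewrite ger0_norm// => /le_trans; apply.
    have c0 : 0 <= c by have := le_trans (normr_ge0 _) (fb 1); rewrite normr1 mulr1.
    by rewrite ler_piMr.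
  by rewrite normrZ ger0_norm// ler_piMl.
apply/eqP; rewrite -subr_eq0 -normr_le0 -/(e t).
apply: (@dyadic_le0 _ (c + `|f 1|)) => k.
have := eb ((2 ^ k)%:R * t); rewrite en normrZ normr_nat natrX exprVn.
by rewrite mulrC -ler_pdivlMr// exprn_gt0.
Qed.

Lemma dyadic_norm (W : normedModType R) k (w : W) : `|h k *: w| = h k * `|w|.
Proof. by rewrite normrZ ger0_norm// ltW// dyadic_gt0. Qed.

Section one_parameter.
Variables (V : normedModType R) (m : nat) (phi : V -> 'M[R]_m).
Hypothesis phiD : forall v s t, phi ((s + t) *: v) = phi (s *: v) *m phi (t *: v).
Hypothesis phi0 : phi 0 = 1%:M.
Hypothesis phi_cont : \forall v \near (0 : V), {for v, continuous phi}.

Local Notation K := (m.+1%:R : R).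
Local Notation Q v := (phi v - 1%:M).

Let K_gt0 : 0 < K. Proof. by rewrite ltr0n. Qed.

Let QD v s t :
  Q ((s + t) *: v) = Q (s *: v) + Q (t *: v) + Q (s *: v) *m Q (t *: v).
Proof.
rewrite phiD mulmxBl !mulmxBr !mul1mx !mulmx1.
set A := phi (s *: v); set B := phi (t *: v).
apply/matrixP => i j; rewrite !mxE; ring.
Qed.

Let small_ball : exists2 r : R, 0 < r & forall v : V, `|v| <= r ->
  {for v, continuous phi} /\ K * `|Q v| <= 2^-1.
Proof.
have K2 : 0 < 2^-1 / K by rewrite divr_gt0.
have phic0 := nbhs_singleton phi_cont.
have /cvgrPdist_le/(_ _ K2) := phic0; rewrite phi0 => near1.
have /nbhs_ballP[r /= r0 Hr] : nbhs (0 : V) [set v | {for v, continuous phi} /\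
    K * `|Q v| <= 2^-1].
  apply: filterS2 phi_cont near1 => v cv; rewrite distrC => Hv; split=> //.
  by rewrite mulrC -ler_pdivlMr.
exists (r / 2) => [|v vr]; first by rewrite divr_gt0.
apply: Hr; rewrite -ball_normE /= sub0r normrN (le_lt_trans vr)//.
by rewrite ltr_pdivrMr// ltr_pMr// ltr1n.
Qed.

(** With [u k = K * |Q (h k *: v)|], the doubling rule [Q (2 w) = 2 Q w + (Q w)^2] gives
    [2 u (k+1) - u (k+1)^2 <= u k]. The sequence [1 / (2^k + 1)] equals [1/2] at [k = 0], has order
    [2^-k] and is compatible with this recursion; a plain multiple of [2^-k] would not survive the
    quadratic term. *)
Let Q_dyadic r : 0 < r ->
  (forall v : V, `|v| <= r -> {for v, continuous phi} /\ K * `|Q v| <= 2^-1) ->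
  forall v : V, `|v| <= r -> forall k, K * `|Q (h k *: v)| <= (2 ^+ k + 1)^-1.
Proof.
move=> r0 Hr v vr.
have vk k : `|h k *: v| <= r.
  by rewrite dyadic_norm (le_trans _ vr)// ler_piMl// dyadic_le1.
elim=> [|k IH]; first by rewrite scale1r expr0 (_ : 1 + 1 = 2)//; have [] := Hr _ vr.
have [_ Hk] := Hr _ (vk k.+1).
set a : R := 2 ^+ k in IH *.
have a0 : 1 <= a by rewrite exprn_ege1// ler1n.
have -> : 2 ^+ k.+1 = 2 * a :> R by rewrite exprS.
set u := K * _ in Hk *.
have u0 : 0 <= u by rewrite mulr_ge0// ltW.
set w := h k.+1 *: v.
have Qw : Q (h k *: v) = Q w + Q w + Q w *m Q w.
  have := QD w 1 1; rewrite scale1r => <-.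
  by rewrite /w scalerA exprS mulrA mulrDl mul1r (_ : 2^-1 + 2^-1 = 1 :> R) ?mul1r//; lra.
have uk : 2 * u - u ^+ 2 <= (a + 1)^-1.
  apply: le_trans IH.
  have -> : Q (h k *: v) = 2 *: Q w + Q w *m Q w by rewrite Qw scaler_nat mulr2n.
  have H1 : `|2 *: Q w| - `|Q w *m Q w| <= `|2 *: Q w + Q w *m Q w|.
    by rewrite -[Q w *m _]opprK normrN lerB_dist.
  have H2 := mulmx_norm_le (Q w) (Q w).
  rewrite normrZ ger0_norm// in H1.
  rewrite /u -/w; set q := `|Q w| in H1 H2 *.
  set p := `|_ *m _| in H1 H2; set z := `|_ + _| in H1 *.
  have : 2 * q - K * q * q <= z by lra.
  by move=> /(ler_wpM2l (ltW K_gt0)); lra.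
have [//|ul] := leP u (2 * a + 1)^-1.
have b0 : 0 < 2 * a + 1 by lra.
have c0 : 0 < a + 1 by lra.
have z1 : (2 * a + 1)^-1 <= 1 by rewrite invf_le1//; lra.
(* [t |-> 2 t - t^2] increases on [[0, 1]], so a [u] above the target would contradict the induction
   hypothesis. *)
have Z1 : 2 * (2 * a + 1)^-1 - (2 * a + 1)^-1 ^+ 2 < 2 * u - u ^+ 2.
  have : 0 < (u - (2 * a + 1)^-1) * (2 - u - (2 * a + 1)^-1).
    by rewrite mulr_gt0//; lra.
  by lra.
have Z2 : (a + 1)^-1 <= 2 * (2 * a + 1)^-1 - (2 * a + 1)^-1 ^+ 2.
  rewrite -subr_ge0.
  rewrite (_ : _ - _ = a * ((2 * a + 1)^-1 ^+ 2 * (a + 1)^-1)).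
    by rewrite !mulr_ge0// ?sqr_ge0 ?invr_ge0 ltW//; lra.
  by field; apply/andP; split; lra.
lra.
Qed.
(** Double [v] as often as the ball allows: [r * h k] then lies between [|v|] and [2 |v|], and the
    dyadic bound at that [k] becomes linear in [|v|], with the constant [2 / r / K]. *)
Let Q_linear r : 0 < r ->
  (forall v : V, `|v| <= r -> {for v, continuous phi} /\ K * `|Q v| <= 2^-1) ->
  exists2 M, 0 <= M & forall v : V, `|v| <= r -> `|Q v| <= M * `|v|.
Proof.
move=> r0 Hr; exists (2 / r / K); first by rewrite !divr_ge0// ltW.
move=> v vr.
have [->|v0] := eqVneq v 0; first by rewrite phi0 subrr !normr0 mulr0.
have vp : 0 < `|v| by rewrite normr_gt0.
have exk : exists k, `|v| <= r * h k < 2 * `|v|.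
  have exP : exists k, r * h k < 2 * `|v|.
    have [k hk] := dyadic_small (divr_gt0 vp r0).
    exists k; move: hk; rewrite ler_pdivlMr// mulrC; lra.
  case: (ex_minnP exP) => k kP kmin; exists k; rewrite kP andbT.
  case: k kP kmin => [|k] kP kmin; first by rewrite mulr1.
  have : ~~ (r * h k < 2 * `|v|) by apply/negP => /kmin; rewrite ltnn.
  by rewrite -leNgt exprS; lra.
have [k /andP[k1 k2]] := exk.
have hk0 := dyadic_gt0 k.
have := @Q_dyadic r r0 Hr ((2 ^+ k) *: v) _ k.
rewrite scalerA -exprMn mulVf// expr1n scale1r => Hk.
have {Hk} : K * `|Q v| <= (2 ^+ k + 1)^-1.
  apply: Hk; rewrite normrZ ger0_norm ?exprn_ge0//.
  by rewrite mulrC -ler_pdivlMr ?exprn_gt0// -exprVn.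
rewrite mulrAC ler_pdivlMr// mulrC => /le_trans; apply.
apply: (@le_trans _ _ (h k)).
  by rewrite exprVn lef_pV2 ?posrE ?addr_gt0 ?exprn_gt0// lerDl.
by rewrite mulrAC ler_pdivlMr// mulrC ltW.
Qed.

(** By the doubling rule consecutive terms of [a v] differ by [2^k] times the square of
    [Q (h k.+1 *: v)], hence by [O(2^-k |v|^2)] thanks to [Q_linear]; summing from [k = 0] gives
    both convergence and the quadratic remainder. *)
Lemma one_parameter_log : exists L : V -> 'M[R]_m,
  [/\ continuous L, forall t v, L (t *: v) = t *: L v &
      exists C r, [/\ 0 <= C, 0 < r, forall v, `|L v| <= C * `|v| &
        forall v, `|v| <= r -> `|phi v - 1%:M - L v| <= C * `|v| ^+ 2]].
Proof.
have [r r0 Hr] := small_ball.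
have [M M0 HM] := Q_linear r0 Hr.
pose a v k := 2 ^+ k *: Q (h k *: v).
pose L v : 'M[R]_m := lim (a v @ \oo).
have two_h k : 2 ^+ k * h k = 1 :> R by rewrite -exprMn divff// expr1n.
have vk (v : V) k : `|v| <= r -> `|h k *: v| <= r.
  by move=> vr; rewrite dyadic_norm (le_trans _ vr)// ler_piMl// dyadic_le1.
have aS v k : a v k.+1 - a v k =
    - (2 ^+ k *: (Q (h k.+1 *: v) *m Q (h k.+1 *: v))).
  rewrite /a; set w := h k.+1 *: v.
  have -> : Q (h k *: v) = Q w + Q w + Q w *m Q w.
    have := QD w 1 1; rewrite scale1r => <-.
    rewrite /w scalerA exprS mulrA mulrDl mul1r (_ : 2^-1 + 2^-1 = 1 :> R) ?mul1r//.
    lra.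
  set A := Q w; set B := _ *m _; rewrite exprS.
  by apply/matrixP => i j; rewrite !mxE; ring.
pose C := K * M ^+ 2.
have C0 : 0 <= C by rewrite mulr_ge0 ?sqr_ge0// ltW.
have a_cauchy (v : V) : `|v| <= r -> forall k,
    `|a v k.+1 - a v k| <= (C * `|v| ^+ 2 / 4) * h k.
  move=> vr k; rewrite aS normrN normrZ ger0_norm ?exprn_ge0//.
  have Hq : `|Q (h k.+1 *: v)| <= M * (2^-1 * h k * `|v|).
    by rewrite -exprS -dyadic_norm; exact: (HM _ (vk v k.+1 vr)).
  have Hqq := mulmx_norm_le (Q (h k.+1 *: v)) (Q (h k.+1 *: v)).
  have H1 : `|Q (h k.+1 *: v) *m Q (h k.+1 *: v)| <= K * (M * (2^-1 * h k * `|v|)) ^+ 2.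
    apply: (le_trans Hqq); rewrite -[leLHS]mulrA.
    apply: ler_wpM2l; [exact: ltW|rewrite expr2].
    exact: (ler_pM (normr_ge0 _) (normr_ge0 _) Hq Hq).
  apply: (le_trans (ler_wpM2l (exprn_ge0 _ _) H1)) => //.
  rewrite le_eqVlt; apply/orP; left; apply/eqP.
  have := two_h k; rewrite /C; set t : R := 2 ^+ k; set x : R := h k => tx.
  have -> : t * (K * (M * (2^-1 * x * `|v|)) ^+ 2) =
    (t * x) * x * (K * M ^+ 2 * `|v| ^+ 2 / 4) by field.
  by rewrite tx mul1r mulrC.
(* The estimates hold only in the ball; a shift of the index replaces [v] by [h n *: v], so that
   convergence extends to every [v]. *)
have a_shift v n : (fun k => a v (k + n)%N) = (fun k => 2 ^+ n *: a (h n *: v) k).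
  apply/funext => k; rewrite /a scalerA exprD mulrC; congr (_ *: (phi _ - _)).
  by rewrite scalerA exprD.
have in_ball (v : V) : exists N, `|h N *: v| <= r.
  have v1 : 0 < `|v| + 1 by rewrite ltr_pwDr.
  have [N hN] := dyadic_small (divr_gt0 r0 v1); exists N.
  have hN0 := dyadic_gt0 N.
  by rewrite dyadic_norm; move: hN; rewrite ler_pdivlMr//; nra.
have a_cvg v : a v @ \oo --> L v.
  have [N hN] := in_ball v; apply/cvg_ex.
  have [+ _] := geometric_cauchy (a_cauchy _ hN) => /cvg_ex[l Hl].
  exists (2 ^+ N *: l); rewrite -(cvg_shiftn N) a_shift.
  by apply: cvgZl_tmp.
have L_dyadic v n : L (h n *: v) = h n *: L v.
  apply: cvg_lim => //.
  have := a_cvg v; rewrite -(cvg_shiftn n) a_shift => Hn.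
  have : h n *: (2 ^+ n *: a (h n *: v) k) @[k --> \oo] --> h n *: L v.
    by apply: cvgZl_tmp.
  by under eq_fun do rewrite scalerA mulrC two_h scale1r.
have L_quad (v : V) : `|v| <= r -> `|Q v - L v| <= C * `|v| ^+ 2.
  move=> vr; have [_ /(_ 0%N)] := geometric_cauchy (a_cauchy _ vr).
  rewrite /a !expr0 !scale1r distrC mulr1 => /le_trans; apply.
  have : 0 <= C * `|v| ^+ 2 by rewrite mulr_ge0// sqr_ge0.
  by rewrite /a/=; lra.
(* At the scale [h n], [QD] makes [L] additive up to four errors of size [C (h n B)^2]; dividing by
   [h n] and letting [n] grow leaves exact additivity. *)
have L_add v s t : L ((s + t) *: v) = L (s *: v) + L (t *: v).
  apply/eqP; rewrite -subr_eq0 -normr_le0.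
  pose B := (`|s| + `|t|) * `|v|.
  have B0 : 0 <= B by rewrite mulr_ge0// addr_ge0.
  have [N hN] : exists N, h N * B <= r.
    have B1 : 0 < B + 1 by lra.
    have [N hN] := dyadic_small (divr_gt0 r0 B1); exists N.
    by have := dyadic_gt0 N; move: hN; rewrite ler_pdivlMr//; lra.
  apply: (@dyadic_le0 _ (4 * C * B ^+ 2)) => k.
  pose n := (N + k)%N.
  have hn0 := dyadic_gt0 n.
  have hnN : h n <= h N by rewrite exprD ler_piMr ?dyadic_le1// ltW ?dyadic_gt0.
  have hnk : h n <= h k by rewrite exprD ler_piMl ?dyadic_le1// ltW ?dyadic_gt0.
  apply: (@le_trans _ _ (4 * C * B ^+ 2 * h n)); last first.
    by rewrite ler_wpM2l// !mulr_ge0// sqr_ge0.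
  have hnB : h n * B <= r by apply: le_trans hN; rewrite ler_wpM2r.
  rewrite -(ler_pM2l hn0) -dyadic_norm scalerBr scalerDr -!L_dyadic.
  set w := h n *: v.
  have swap u : h n *: (u *: v) = u *: w by rewrite !scalerA mulrC.
  rewrite !swap.
  have wB u : `|u| <= `|s| + `|t| -> `|u *: w| <= h n * B.
    move=> ust; rewrite normrZ dyadic_norm mulrCA (ler_wpM2l (ltW hn0))//.
    by rewrite /B ler_wpM2r.
  have sB : `|s *: w| <= h n * B by apply: wB; rewrite lerDl.
  have tB : `|t *: w| <= h n * B by apply: wB; rewrite lerDr.
  have stB : `|(s + t) *: w| <= h n * B by apply: wB; exact: ler_normD.
  have quad u : `|u *: w| <= h n * B -> `|Q (u *: w) - L (u *: w)| <= C * (h n * B) ^+ 2.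
    move=> uB; apply: le_trans (L_quad _ (le_trans uB hnB)) _.
    by rewrite ler_wpM2l// lerXn2r// ?nnegrE// mulr_ge0// ltW.
  have Hs := quad _ sB; have Ht := quad _ tB; have Hst := quad _ stB.
  have Hp : `|Q (s *: w) *m Q (t *: w)| <= C * (h n * B) ^+ 2.
    apply: le_trans (mulmx_norm_le _ _) _.
    rewrite /C -!mulrA (ler_wpM2l (ltW K_gt0))//.
    have q1 := le_trans (HM _ (le_trans sB hnB)) (ler_wpM2l M0 sB).
    have q2 := le_trans (HM _ (le_trans tB hnB)) (ler_wpM2l M0 tB).
    apply: le_trans (ler_pM (normr_ge0 _) (normr_ge0 _) q1 q2) _.
    by rewrite le_eqVlt; apply/orP; left; apply/eqP; ring.
  have -> : L ((s + t) *: w) - (L (s *: w) + L (t *: w)) =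
      (Q (s *: w) - L (s *: w)) + (Q (t *: w) - L (t *: w)) -
      (Q ((s + t) *: w) - L ((s + t) *: w)) + Q (s *: w) *m Q (t *: w).
    rewrite [Q ((s + t) *: w)]QD.
    set q1 := Q _; set q2 := Q _; set q3 := _ *m _.
    by apply/matrixP => i j; rewrite !mxE; ring.
  apply: le_trans (ler_normD _ _) _.
  have T1 := ler_normB (Q (s *: w) - L (s *: w) + (Q (t *: w) - L (t *: w)))
     (Q ((s + t) *: w) - L ((s + t) *: w)).
  have T2 := ler_normD (Q (s *: w) - L (s *: w)) (Q (t *: w) - L (t *: w)).
  apply: le_trans (lerD (le_trans T1 (lerD (le_trans T2 (lerD Hs Ht)) Hst)) Hp) _.
  by rewrite le_eqVlt; apply/orP; left; apply/eqP; ring.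
(* Inside the ball [|L w| <= |Q w| + C |w|^2], where one factor [|w|] is at most [r]; dyadic
   homogeneity carries the bound outside. *)
have L_bound v : `|L v| <= (M + C * r) * `|v|.
  have [N hN] := in_ball v.
  have h0 := dyadic_gt0 N.
  rewrite -(ler_pM2l h0) mulrCA -!dyadic_norm -L_dyadic.
  set w := h N *: v in hN *.
  rewrite -[L w](subKr (Q w)); apply: le_trans (ler_normB _ _) _.
  have := HM _ hN; have := L_quad _ hN.
  have := normr_ge0 w; move: (`|w|) hN => x xr x0 H1 H2.
  have : C * x ^+ 2 <= C * (r * x) by rewrite ler_wpM2l// expr2 ler_wpM2r.
  lra.
exists L; split.
(* Continuity by a three-term estimate at the scale [h k]: each replacement of [L] by [Q] costs
   [O((h k)^2)], below [h k * (e / 3)] for large [k], and [phi] is continuous at [h k *: v]. The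
   radius [b = |v| + 1] also covers the neighbours [u]. *)
- move=> v; apply/cvgrPdist_le => e e0.
  pose b := `|v| + 1.
  have b0 : 0 < b by rewrite ltr_pwDr.
  have [k1 Hk1] := dyadic_small (divr_gt0 r0 b0).
  have Cb1 : 0 < C * b ^+ 2 + 1 by rewrite ltr_pwDr// mulr_ge0// sqr_ge0.
  have e3 : 0 < e / 3 by rewrite divr_gt0.
  have [k2 Hk2] := dyadic_small (divr_gt0 e3 Cb1).
  pose k := (k1 + k2)%N.
  have hk0 := dyadic_gt0 k.
  have hk1 : h k <= h k1 by rewrite exprD ler_piMr ?dyadic_le1// ltW ?dyadic_gt0.
  have hk2 : h k <= h k2 by rewrite exprD ler_piMl ?dyadic_le1// ltW ?dyadic_gt0.
  have kb : h k * b <= r.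
    by apply: le_trans (ler_wpM2r (ltW b0) hk1) _; rewrite -ler_pdivlMr.
  have kC : C * b ^+ 2 * h k <= e / 3.
    have := le_trans hk2 Hk2; rewrite ler_pdivlMr// mulrDr mulr1.
    by rewrite [h k * _]mulrC => H; lra.
  have small u : `|u| <= b -> `|Q (h k *: u) - L (h k *: u)| <= C * (h k * b) ^+ 2.
    move=> ub; have ukb : `|h k *: u| <= h k * b by rewrite dyadic_norm ler_wpM2l// ltW.
    apply: le_trans (L_quad _ (le_trans ukb kb)) _.
    by rewrite ler_wpM2l// lerXn2r// ?nnegrE// mulr_ge0// ltW.
  have vb : `|v| <= b by rewrite lerDl.
  have vkr : `|h k *: v| <= r.
    by apply: le_trans kb; rewrite dyadic_norm ler_wpM2l// ltW.
  have [phic _] := Hr _ vkr.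
  have scc : {for v, continuous (fun u : V => h k *: u)}.
    by apply: cvgZl_tmp; exact: cvg_id.
  have /cvgrPdist_le/(_ (h k * (e / 3))) := continuous_at_comp scc phic.
  rewrite mulr_gt0// => /(_ isT) near1.
  have near2 : \forall u \near v, `|v - u| <= 1.
    by have /cvgrPdist_le := @cvg_id _ (nbhs v); exact.
  apply: filterS2 near1 near2 => u Hu1 Hu2.
  have ub : `|u| <= b.
    rewrite -[u](subKr v) /b; apply: le_trans (ler_normB _ _) _.
    by rewrite lerD2l.
  have Sv := small _ vb; have Su := small _ ub.
  rewrite -(ler_pM2l hk0) -dyadic_norm scalerBr -!L_dyadic.
  have -> : L (h k *: v) - L (h k *: u) =
     (phi (h k *: v) - phi (h k *: u)) + (Q (h k *: u) - L (h k *: u))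
     - (Q (h k *: v) - L (h k *: v)).
    by apply/matrixP => i j; rewrite !mxE; ring.
  apply: le_trans (ler_normB _ _) _.
  have T1 := ler_normD (phi (h k *: v) - phi (h k *: u)) (Q (h k *: u) - L (h k *: u)).
  have T3 : C * (h k * b) ^+ 2 <= h k * (e / 3).
    rewrite (_ : C * _ = h k * (C * b ^+ 2 * h k)); last by ring.
    by rewrite ler_wpM2l// ltW.
  have -> : h k * e = h k * (e / 3) + h k * (e / 3) + h k * (e / 3) by field.
  exact: (lerD (le_trans T1 (lerD Hu1 (le_trans Su T3))) (le_trans Sv T3)).
- move=> t v; have := @additive_homogeneous _ (fun t => L (t *: v)) ((M + C * r) * `|v|).
  rewrite scale1r; apply; first by move=> *; exact: L_add.
  by move=> s; apply: le_trans (L_bound _) _; rewrite normrZ mulrA mulrAC.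
- have Cr : 0 <= C * r by rewrite mulr_ge0// ltW.
  exists (M + C * r + C), r; split=> //; first by lra.
    by move=> v; apply: le_trans (L_bound v) _; rewrite ler_wpM2r//; lra.
  move=> v vr; apply: le_trans (L_quad v vr) _.
  by rewrite ler_wpM2r ?sqr_ge0//; lra.
Qed.

End one_parameter.
End dyadic.

(** * Smoothness of continuous representations *)

Lemma cvg_mulmx (R : realType) (T : Type) (F : set_system T) {FF : Filter F}
    (m n p : nat) (f : T -> 'M[R]_(m, n)) (g : T -> 'M[R]_(n, p))
    (A : 'M[R]_(m, n)) (B : 'M[R]_(n, p)) :
  f t @[t --> F] --> A -> g t @[t --> F] --> B ->
  (f t *m g t) @[t --> F] --> A *m B.
Proof.
move=> fA gB; apply: cvg_mx_entries => i j; rewrite mxE.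
under eq_fun do rewrite mxE.
apply: cvg_sumr => k _; apply: cvgM.
  exact: (continuous_cvg _ (@coord_continuous _ _ _ i k A) fA).
exact: (continuous_cvg _ (@coord_continuous _ _ _ k j B) gB).
Qed.

Lemma is_derive_mulmxl (R : realType) (V : normedModType R) (m n p : nat)
    (A : 'M[R]_(m, n)) (f : V -> 'M[R]_(n, p)) (x v : V) (df : 'M[R]_(n, p)) :
  is_derive x v f df -> is_derive x v (fun y => A *m f y) (A *m df).
Proof.
move=> [dfx <-].
have H : (fun h : R => h^-1 *: (((fun y => A *m f y) \o shift x) (h *: v) - A *m f x))
    @ 0^' --> A *m 'D_v f x.
  under eq_fun do rewrite /= -mulmxBr scalemxAr.
  by apply: cvg_mulmx; [exact: cvg_cst|exact: dfx].
by apply: DeriveDef; [exact: cvgP H|exact: cvg_lim H].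
Qed.

Lemma is_derive_mx_entry (R : realType) (V : normedModType R) (m n : nat)
    (f : V -> 'M[R]_(m, n)) (x v : V) (df : 'M[R]_(m, n)) i j :
  is_derive x v f df -> is_derive x v (fun y => f y i j : R) (df i j).
Proof.
move=> [dfx <-]; apply: DeriveDef; first by move/derivable_mxP: dfx; apply.
by rewrite derive_mx// mxE.
Qed.

Lemma is_derive_mx (R : realType) (V : normedModType R) (m n : nat)
    (f : V -> 'M[R]_(m, n)) (x v : V) (df : 'M[R]_(m, n)) :
  (forall i j, is_derive x v (fun y => f y i j : R) (df i j)) ->
  is_derive x v f df.
Proof.
move=> H; have dfx : derivable f x v by apply/derivable_mxP => i j; case: (H i j).
apply: DeriveDef => //; rewrite derive_mx//; apply/matrixP => i j.
by rewrite mxE; case: (H i j).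
Qed.

(** Since [L] commutes with scalars, [h^-1 *: L (gam h)] is [L (h^-1 *: gam h)], which tends to
    [L w] by continuity; the remainder is [O(|gam h|^2) = o(h)]. This avoids the linearity of [L],
    which is established only later. *)
Lemma is_derive_log_curve (R : realType) (V : normedModType R) (m : nat)
    (phi L : V -> 'M[R]_m) (C r : R) (gam : R -> V) (w : V) :
  continuous L -> (forall t v, L (t *: v) = t *: L v) ->
  0 < r -> phi 0 = 1%:M ->
  (forall v, `|v| <= r -> `|phi v - 1%:M - L v| <= C * `|v| ^+ 2) ->
  gam 0 = 0 -> is_derive (0 : R) (1 : R) gam w ->
  is_derive (0 : R) (1 : R) (fun t => phi (gam t)) (L w).
Proof.
move=> cL ZL r0 phi0 quad gam0 [dgam gamw].
have gam_cont : {for 0, continuous gam}.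
  by apply/differentiable_continuous/derivable1_diffP.
have gamq : (h^-1 *: gam h) @[h --> 0^'] --> w.
  rewrite -gamw; move: dgam; rewrite /derivable/derive.
  suff -> : (fun h : R => h^-1 *: ((gam \o shift 0) (h *: 1) - gam 0)) =
    (fun h => h^-1 *: gam h) by [].
  by apply/funext => h /=; rewrite gam0 subr0 addr0 [h *: 1]mulr1.
pose E v := phi v - 1%:M - L v.
have Eq : (h^-1 *: E (gam h)) @[h --> 0^'] --> (0 : 'M[R]_m).
  have bound : C * `|h^-1 *: gam h| * `|gam h| @[h --> 0^'] --> (0 : R).
    have g0 : `|gam h| @[h --> 0^'] --> (0 : R).
      have : gam h @[h --> 0^'] --> (0 : V).
        move: gam_cont; rewrite /prop_for /continuous_at gam0; apply: cvg_trans.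
        exact: (cvg_fmap2 (@cvg_within _ (nbhs (0 : R)) _ _)).
      by move=> /cvg_norm; rewrite normr0.
    suff : C * `|h^-1 *: gam h| * `|gam h| @[h --> 0^'] --> C * `|w| * 0.
      by rewrite mulr0.
    by apply: (cvgM _ g0); apply: (cvgM _ (cvg_norm gamq)); exact: cvg_cst.
  have gam_small : \forall h \near 0^', `|gam h| <= r.
    apply: nbhs_dnbhs; have /cvgrPdist_le/(_ _ r0) := gam_cont.
    by rewrite gam0; apply: filterS => h; rewrite sub0r normrN.
  apply/cvgrPdist_le => e e0; have /cvgrPdist_le/(_ _ e0) := bound.
  apply: filterS2 gam_small => h hr; rewrite !sub0r !normrN.
  apply: le_trans; apply: le_trans (ler_norm _); rewrite !normrZ.
  have := ler_wpM2l (normr_ge0 h^-1) (quad _ hr).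
  by rewrite -/(E _) => /le_trans; apply; rewrite expr2 mulrCA !mulrA.
have H : (fun h : R => h^-1 *: (((fun t => phi (gam t)) \o shift 0) (h *: 1) - phi (gam 0)))
    @ 0^' --> L w.
  have -> : (fun h : R => h^-1 *: (((fun t => phi (gam t)) \o shift 0) (h *: 1) - phi (gam 0))) =
      (fun h => L (h^-1 *: gam h) + h^-1 *: E (gam h)).
    apply/funext => h /=; rewrite gam0 addr0 [h *: 1]mulr1 phi0 ZL -scalerDr.
    by congr (_ *: _); rewrite /E addrCA subrr addr0.
  rewrite -[L w]addr0; apply: cvgD => //.
  exact: (continuous_cvg _ (cL w) gamq).
by apply: DeriveDef; [exact: cvgP H|exact: cvg_lim H].
Qed.

(** * The exponential map in the coordinates of a basis *)

Section exponential.
Variables (R : realType) (d : nat) (G : lieGroupType R d).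
Variables (expG : lie_algebra G -> G) (expGP : is_exponential expG).
Variable X : 'I_d -> lie_algebra G.

Definition lie_comb (v : 'rV[R]_d) : lie_algebra G := \sum_(i < d) v 0 i *: X i.

Lemma lie_combZ t v : lie_comb (t *: v) = t *: lie_comb v.
Proof.
by rewrite /lie_comb scaler_sumr; apply: eq_bigr => i _; rewrite mxE scalerA.
Qed.

Lemma lie_comb0 : lie_comb 0 = 0.
Proof. by rewrite /lie_comb big1 // => i _; rewrite mxE scale0r. Qed.

Lemma lie_comb_delta i : lie_comb (delta_mx 0 i) = X i.
Proof.
rewrite /lie_comb (bigD1 i)//= mxE !eqxx scale1r big1 ?addr0// => j ji.
by rewrite mxE (negbTE ji) andbF scale0r.
Qed.

Lemma exp0 : expG 0 = 1%g.
Proof.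
have [_ H _] := expGP 0; have := H 0 0.
rewrite addr0 scale0r => E.
by apply: (@mulgI _ (expG 0)); rewrite mulg1 -E.
Qed.

Definition exp_coord (v : 'rV[R]_d) : G := expG (lie_comb v).

Lemma exp_coord0 : exp_coord 0 = 1%g.
Proof. by rewrite /exp_coord lie_comb0 exp0. Qed.

Lemma exp_coordD v s t :
  exp_coord ((s + t) *: v) = (exp_coord (s *: v) * exp_coord (t *: v))%g.
Proof. by rewrite /exp_coord !lie_combZ; have [_ -> _] := expGP (lie_comb v). Qed.

Lemma is_derive_exp_coord (f : G -> R) (v : 'rV[R]_d) : smooth f ->
  is_derive (0 : R) (1 : R) (fun t : R => f (exp_coord (t *: v)) : R) (lie_comb v f).
Proof.
move=> sf; have [_ _ /(_ f sf)] := expGP (lie_comb v).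
by under eq_fun do rewrite -lie_combZ.
Qed.

End exponential.

Lemma near_eq_continuous (T S : topologicalType) (f g : T -> S) (x : T) :
  (\forall y \near x, f y = g y) ->
  {for x, continuous f} -> {for x, continuous g}.
Proof.
move=> fg cf; rewrite /prop_for /continuous_at -(nbhs_singleton fg).
by apply: cvg_trans cf; exact: near_eq_cvg.
Qed.

Lemma smooth_map_sub (R : realType) (d : nat) (G : lieGroupType R d)
    (V : normedModType R) (O N : set V) (p : V -> G) :
  N `<=` O -> smooth_map O p -> smooth_map N p.
Proof.
move=> NO [cp sp]; split=> [v /NO/cp//|c ac k i].
by apply: Ck_sub (sp c ac k i) => v [/NO].
Qed.

Lemma continuous_compact_bounded (R : realType) (T : topologicalType)
    (W : normedModType R) (f : T -> W) :
  compact [set: T] -> continuous f -> exists M, forall t, `|f t| <= M.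
Proof.
move=> cT cf.
have : compact (f @` setT).
  by apply: continuous_compact => //; exact: continuous_subspaceT.
move=> /compact_bounded[M [_ HM]]; exists (M + 1) => t.
by apply: (HM (M + 1)); [rewrite ltrDl|exists t].
Qed.

(** * Logarithm and smoothness of a real representation *)

Section representation.
Variables (R : realType) (d : nat) (G : lieGroupType R d).
Hypothesis Gcompact : compact [set: G].
Variables (expG : lie_algebra G -> G) (expGP : is_exponential expG).
Variables (X : 'I_d -> lie_algebra G) (U : set G) (x : 'I_d -> G -> R).
Hypothesis Ux : canonical_coordinates expG X U x.
Variables (m : nat) (rho : G -> 'M[R]_m).
Hypothesis rhoM : forall g h, rho (g * h)%g = rho g *m rho h.
Hypothesis rho1 : rho 1%g = 1%:M.
Hypothesis rho_cont : continuous rho.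

Local Notation expc := (exp_coord expG X).
Local Notation xv := (fun g : G => \row_(i < d) x i g : 'rV[R]_d).

Lemma exp_coord_coords g : U g -> expc (xv g) = g.
Proof.
move=> Ug; have [_ _ _ _ H] := Ux; rewrite [RHS](H g Ug) /exp_coord /lie_comb.
by congr (expG _); apply: eq_bigr => i _; rewrite mxE.
Qed.

Lemma coords1 i : x i 1%g = 0.
Proof.
have [_ _ [_ H] _ _] := Ux.
by have /= := congr1 (fun v : 'rV[R]_d => v 0 i) H; rewrite !mxE.
Qed.

(** The access to joint smoothness of the exponential: on the coordinate image of [U] it coincides
    with the smooth inverse [y] of the coordinates. *)
Lemma exp_coord_chart : exists (O : set 'rV[R]_d) (y : 'rV[R]_d -> G),
  [/\ open O, O 0, smooth_map O y & forall v, O v -> y v = expc v].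
Proof.
have [[_ U1] _ [oO x1] [y [yx ys]] _] := Ux.
exists (xv @` U), y; split => //; first by exists 1%g.
  exact: smooth_into_map.
by move=> _ [g Ug <-]; rewrite yx// exp_coord_coords.
Qed.

Lemma rho_log : exists L : 'rV[R]_d -> 'M[R]_m,
  [/\ continuous L, forall t v, L (t *: v) = t *: L v &
      exists C, forall v, `|rho (expc v) - 1%:M - L v| <= C * `|v| ^+ 2].
Proof.
have [N [y [oN N0 [cy _] yE]]] := exp_coord_chart.
have phiD v s t : rho (expc ((s + t) *: v)) =
    rho (expc (s *: v)) *m rho (expc (t *: v)) by rewrite exp_coordD.
have phi0 : rho (expc 0) = 1%:M by rewrite exp_coord0.
have phic : \forall v \near (0 : 'rV[R]_d), {for v, continuous (fun v => rho (expc v))}.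
  have : nbhs (0 : 'rV[R]_d) N by exact: open_nbhs_nbhs.
  apply: filterS => v Nv.
  have cv : {for v, continuous (fun v => rho (y v))}.
    exact: (continuous_at_comp (cy _ Nv) (@rho_cont _)).
  apply: near_eq_continuous cv; have : nbhs v N by exact: open_nbhs_nbhs.
  by apply: filterS => w Nw; rewrite yE.
have [L [cL ZL [C [r [C0 r0 bL quad]]]]] := one_parameter_log phiD phi0 phic.
exists L; split => //.
have [B HB] := continuous_compact_bounded Gcompact rho_cont.
have B0 : 0 <= B by exact: le_trans (normr_ge0 _) (HB 1%g).
pose D := B + `|1%:M : 'M[R]_m|.
have D0 : 0 <= D by rewrite addr_ge0.
(* For [|v| > r] the left side is at most [D + C |v|], with [D] from the boundedness of [rho] on a
   compact group, and [1 <= |v| / r] turns this into a multiple of [|v|^2]. The bound is made global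
   because the coordinates of points of [U] need not be small. *)
exists (C + D / r ^+ 2 + C / r) => v.
have v0 := normr_ge0 v.
have r20 : 0 < r ^+ 2 by rewrite exprn_gt0.
have [vr|vr] := leP `|v| r.
  apply: le_trans (quad _ vr) _; rewrite ler_wpM2r ?sqr_ge0// -addrA lerDl.
  by rewrite addr_ge0// divr_ge0// ltW.
have H1 : `|rho (expc v) - 1%:M - L v| <= D + C * `|v|.
  apply: le_trans (ler_normB _ _) _; apply: lerD (bL v).
  by apply: le_trans (ler_normB _ _) _; rewrite lerD2r.
clearbody D.
apply: le_trans H1 _; rewrite !mulrDl -addrA ler_wpDl ?mulr_ge0 ?sqr_ge0//.
have vr1 : 1 <= `|v| / r by rewrite ler_pdivlMr// mul1r ltW.
have vr2 : 1 <= (`|v| / r) ^+ 2 by rewrite exprn_ege1.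
apply: lerD.
  have -> : D / r ^+ 2 * `|v| ^+ 2 = D * (`|v| / r) ^+ 2.
    by field; rewrite gt_eqF.
  by rewrite ler_peMr.
have -> : C / r * `|v| ^+ 2 = C * `|v| * (`|v| / r) by field; rewrite gt_eqF.
by rewrite ler_peMr// mulr_ge0.
Qed.

Section pullback.
Variables (V : normedModType R) (O : set V) (q : V -> G).
Hypotheses (openO : open O) (sq : smooth_map O q).

(* [omega v w] is the value at [w] of the pullback by [q] of the left
   Maurer-Cartan form, in the coordinates of the basis [X]. *)
Definition increment i (a : V * V) : R := x i ((q a.1)^-1 * q a.2)%g.
Definition omega (v w : V) : 'rV[R]_d :=
  \row_i 'D_((0, w) : V * V) (increment i) (v, v).

Lemma Ck_increment k i : Ck k (O `*` O) (increment i).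
Proof.
have sx : smooth (x i) by have [_ /(_ i)[]] := Ux.
have oOO : open (O `*` O) by exact: open_setX.
apply: (smooth_comp_map oOO k sx); apply: smooth_map_mul => //.
  apply: smooth_map_inv => //.
  apply: (@smooth_map_sub _ _ _ _ (fst @^-1` O)); first by move=> v [].
  by apply: smooth_map_precomp_linear => // v; exact: cvg_fst.
apply: (@smooth_map_sub _ _ _ _ (snd @^-1` O)); first by move=> v [].
by apply: smooth_map_precomp_linear => // v; exact: cvg_snd.
Qed.

(** A derivative along [(0, w)] of a function smooth jointly in both points, restricted to the
    diagonal, which is a linear map: only one order is lost, hence [Ck_increment] at [k.+1]. *)
Lemma Ck_omega k w i : Ck k O (fun v => omega v w 0 i : R).
Proof.
have H := Ck_derive ((0, w) : V * V) (Ck_increment k.+1 i).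
have diagc : continuous (fun v : V => (v, v)).
  by move=> v; apply: continuous_pair; exact: cvg_id.
have K0 : Ck k ((fun v : V => (v, v)) @^-1` (O `*` O))
    (fun v => 'D_((0, w) : V * V) (increment i) (v, v)).
  exact: (Ck_precomp_linear _ diagc H).
rewrite (_ : (fun v => _) = (fun v => 'D_((0, w) : V * V) (increment i) (v, v))).
  by apply: Ck_sub K0 => v Ov; split.
by apply/funext => v; rewrite mxE.
Qed.

(** Multiplicativity gives [rho (q (v + t w)) = rho (q v) *m rho (g t)] with
    [g t = (q v)^-1 * q (v + t w)]. For small [t] the point [g t] lies in [U], so
    [g t = expc (gam t)], and [gam] has derivative [omega v w] at [0]. *)
Lemma is_derive_rho_pullback (L : 'rV[R]_d -> 'M[R]_m) (C : R) (v w : V) :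
  continuous L -> (forall t v, L (t *: v) = t *: L v) ->
  (forall v, `|rho (expc v) - 1%:M - L v| <= C * `|v| ^+ 2) ->
  O v -> is_derive v w (fun u => rho (q u)) (rho (q v) *m L (omega v w)).
Proof.
move=> cL ZL quad Ov.
pose gam (t : R) : 'rV[R]_d := \row_i x i ((q v)^-1 * q (t *: w + v))%g.
have gam0 : gam 0 = 0.
  by apply/rowP => i; rewrite !mxE scale0r add0r mulVg coords1.
have dgam : is_derive (0 : R) (1 : R) gam (omega v w).
  apply: is_derive_mx => i j; rewrite (ord1 i).
  have /derivableP/is_derive_along : derivable (increment j) (v, v) ((0, w) : V * V).
    by apply: (Ck_derivable (Ck_increment 1 j)).
  rewrite mxE (_ : (fun y => gam y 0 j) =
    (fun h : R => increment j (h *: ((0, w) : V * V) + (v, v)))) //.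
  apply/funext => t; rewrite /gam mxE /increment /=.
  by rewrite scaler0 add0r.
apply/is_derive_along.
have := is_derive_mulmxl (rho (q v))
  (is_derive_log_curve cL ZL ltr01 _ (fun v _ => quad v) gam0 dgam).
rewrite /= exp_coord0// => /(_ rho1); apply: near_eq_is_derive.
have [cq _] := sq.
have ct : {for 0, continuous (fun t : R => ((q v)^-1 * q (t *: w + v))%g)}.
  have c1 : {for 0, continuous (fun t : R => t *: w + v)}.
    by apply: cvgD; [apply: cvgZr_tmp; exact: cvg_id|exact: cvg_cst].
  have c2 : {for 0, continuous (fun t : R => q (t *: w + v))}.
    by apply: (continuous_at_comp c1); rewrite scale0r add0r; exact: cq.
  have c3 : {for 0, continuous (fun t : R => ((q v)^-1)%g)} by exact: cvg_cst.
  exact: (continuous_at_comp (continuous_pair c3 c2) (@lie_mul_continuous _ _ _ _ _)).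
have U1 : nbhs ((q v)^-1 * q (0 *: w + v))%g U.
  rewrite scale0r add0r mulVg; have [[oU U1] _ _ _ _] := Ux.
  exact: open_nbhs_nbhs.
have : \forall t \near (0 : R), U ((q v)^-1 * q (t *: w + v))%g := ct _ U1.
apply: filterS => t Ut.
by rewrite -rhoM exp_coord_coords// mulgA mulgV mul1g.
Qed.

End pullback.

Section log.
Variables (L : 'rV[R]_d -> 'M[R]_m) (C : R).
Hypotheses (cL : continuous L) (ZL : forall t v, L (t *: v) = t *: L v).
Hypothesis quad : forall v, `|rho (expc v) - 1%:M - L v| <= C * `|v| ^+ 2.

Lemma is_derive_rho_exp v :
  is_derive (0 : R) (1 : R) (fun t : R => rho (expc (t *: v))) (L v).
Proof.
apply: (is_derive_log_curve cL ZL ltr01 _ (fun v _ => quad v)).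
- by rewrite exp_coord0.
- by rewrite scale0r.
- have /is_derive_along := is_derive_id (0 : 'rV[R]_d) v.
  by under eq_fun do rewrite addr0.
Qed.

Lemma rho_log_linear v : L v = \sum_(k < d) v 0 k *: L (delta_mx 0 k).
Proof.
have [N [y [oN N0 sy yE]]] := exp_coord_chart.
have nN u : N u -> nbhs u N by move=> Nu; exact: open_nbhs_nbhs.
have dy u w : N u -> is_derive u w (fun u => rho (y u)) (rho (y u) *m L (omega y u w)).
  by move=> Nu; exact: (is_derive_rho_pullback oN sy w cL ZL quad Nu).
(* Two formulas for the same derivatives: [dy] gives their existence near [0] and continuity at [0],
   while [dy0], from [y = expc] near [0], gives their value [L w] at [0], which must then be the
   differential. *)
have dy0 w i j : is_derive (0 : 'rV[R]_d) w (fun u => rho (y u) i j : R) (L w i j).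
  apply: is_derive_mx_entry; apply/is_derive_along.
  apply: near_eq_is_derive (is_derive_rho_exp w).
  have cw : {for 0, continuous (fun t : R => t *: w + 0)}.
    by apply: cvgD; [apply: cvgZr_tmp; exact: cvg_id|exact: cvg_cst].
  have : \forall t \near (0 : R), N (t *: w + 0).
    by apply: cw; rewrite scale0r add0r; exact: nN.
  by apply: filterS => t Nt; rewrite yE// addr0.
apply/matrixP => i j; rewrite summxE.
pose f (u : 'rV[R]_d) : R := rho (y u) i j.
have df : differentiable f 0.
  apply: C1_differentiable => [|k].
    have := nN _ N0; apply: filterS => u Nu k.
    by have [] := is_derive_mx_entry i j (dy u (delta_mx 0 k) Nu).
  have E u : N u -> (rho (y u) *m L (omega y u (delta_mx 0 k))) i j =
      'D_(delta_mx 0 k) f u.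
    by move=> Nu; have [_ <-] := is_derive_mx_entry i j (dy u (delta_mx 0 k) Nu).
  apply: (@near_eq_continuous _ _
    (fun u => (rho (y u) *m L (omega y u (delta_mx 0 k))) i j)).
    by have := nN _ N0; apply: filterS => u; exact: E.
  have c1 : {for 0, continuous (fun u => rho (y u))}.
    have [cy _] := sy.
    exact: (continuous_at_comp (cy _ N0) (@rho_cont _)).
  have c2 : {for 0, continuous (fun u => L (omega y u (delta_mx 0 k)))}.
    suff co : {for 0, continuous (fun u => omega y u (delta_mx 0 k))}.
      exact: (continuous_at_comp co (@cL _)).
    apply: (@cvg_mx_entries _ _ _ (nbhs_filter _)) => a l; rewrite (ord1 a).
    exact: (Ck_continuous (Ck_omega oN sy 0 _ l) N0).
  have c3 : {for 0, continuous (fun u => rho (y u) *m L (omega y u (delta_mx 0 k)))}.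
    exact: (cvg_mulmx c1 c2).
  exact: (continuous_at_comp c3 (@coord_continuous _ _ _ i j _)).
have dfE w : L w i j = 'd f 0 w by rewrite -deriveE//; case: (dy0 w i j).
rewrite dfE {1}(row_sum_delta v) linear_sum; apply: eq_bigr => k _ /=.
by rewrite linearZ /= mxE dfE.
Qed.

(** Linearity of [L] turns [L (omega q v w)] into a combination of the smooth entries of [omega]
    with constant matrices, so a derivative of [rho \o q] is as regular as [rho \o q] itself;
    induction on [k] gains one order at a time. *)
Lemma Ck_rho_pullback (V : normedModType R) (O : set V) (q : V -> G) k i j :
  open O -> smooth_map O q -> Ck k O (fun v => rho (q v) i j : R).
Proof.
move=> oO sq; elim: k i j => [|k IH] i j.
  split=> // v Ov; have [cq _] := sq.
  apply: (continuous_at_comp (f := fun v => rho (q v)) (g := fun M : 'M[R]_m => M i j : R)).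
    exact: (continuous_at_comp (cq v Ov) (@rho_cont _)).
  exact: coord_continuous.
have dq v w : O v -> is_derive v w (fun u => rho (q u) i j : R)
    (\sum_(l < m) rho (q v) i l * \sum_(a < d) omega q v w 0 a * L (delta_mx 0 a) l j).
  move=> Ov; have dqv := is_derive_mx_entry i j
    (is_derive_rho_pullback oO sq w cL ZL quad Ov).
  apply: (is_derive_eq dqv); rewrite mxE; apply: eq_bigr => l _.
  rewrite (rho_log_linear (omega q v w)) summxE; congr (_ * _).
  by apply: eq_bigr => a _; rewrite mxE.
split=> [v Ov|w]; first exact: (Ck_continuous (IH i j) Ov).
split=> [v Ov|]; first by case: (dq v w Ov).
have K0 : Ck k O (fun v => \sum_(l < m) rho (q v) i l *
    \sum_(a < d) omega q v w 0 a * L (delta_mx 0 a) l j).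
  apply: (Ck_sum oO) => l; apply: (Ck_mul oO (IH i l)).
  apply: (Ck_sum oO) => a; apply: (Ck_mul oO); last exact: Ck_cst.
  exact: (Ck_omega oO sq).
by apply: (Ck_ext oO) K0 => v Ov; case: (dq v w Ov).
Qed.

End log.

Lemma representation_smooth :
  (forall i j, smooth (fun g => rho g i j)) /\
  exists C, forall v, `|rho (expc v) - 1%:M -
    \matrix_(i, j) \sum_(k < d) v 0 k * X k (fun g => rho g i j)| <= C * `|v| ^+ 2.
Proof.
have [L [cL ZL [C quad]]] := rho_log.
have srho i j : smooth (fun g => rho g i j).
  move=> c ac k; apply: (Ck_rho_pullback cL ZL quad); first exact: chart_im_open.
  exact: smooth_map_chart_inv.
split=> //; exists C => v.
suff <- : L v = \matrix_(i, j) \sum_(k < d) v 0 k * X k (fun g => rho g i j) by [].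
rewrite (rho_log_linear cL ZL quad v); apply/matrixP => i j.
rewrite summxE mxE; apply: eq_bigr => k _; rewrite mxE; congr (_ * _).
(* The derivative along [t |-> expc (t e_k)] is computed once through [L] and once through
   [is_exponential], which identifies [L e_k]. *)
have [_ <-] := is_derive_mx_entry i j (is_derive_rho_exp cL ZL quad (delta_mx 0 k)).
have [_ ->] := is_derive_exp_coord expGP X (delta_mx 0 k) (srho i j).
by rewrite lie_comb_delta.
Qed.

End representation.

(** * Integration against a Levy measure *)

Lemma continuous_measurable_borel (R : realType) (T : ptopologicalType)
    (f : T -> R) :
  continuous f -> measurable_fun (setT : set (borel T)) (f : borel T -> R).
Proof.
move=> /continuousP cf; apply: (measurability _ (RGenOpens.measurableE R)).
move=> _ [_ [a [b ->] <-]]; rewrite setTI.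
by apply: sub_sigma_algebra; exact/cf/interval_open.
Qed.

Lemma levy_integrable (R : realType) (d : nat) (G : lieGroupType R d)
    (expG : lie_algebra G -> G) (X : 'I_d -> lie_algebra G) (U : set G)
    (x : 'I_d -> G -> R) (mu : {measure set (borel G) -> \bar R})
    (f : G -> R) (C : R) :
  compact [set: G] -> canonical_coordinates expG X U x ->
  levy_measure expG X mu -> continuous f ->
  (forall g, U g -> `|f g| <= C * \sum_(i < d) x i g ^+ 2) ->
  mu.-integrable [set: borel G] (fun g : borel G => (f g)%:E).
Proof.
move=> cG Ux [_ /(_ _ _ Ux)[muU muUc]] cf fC.
have [B HB] := continuous_compact_bounded cG cf.
have mf := continuous_measurable_borel cf.
have mU : measurable (U : set (borel G)).
  by apply: sub_sigma_algebra; have [[]] := Ux.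
have mUc : measurable (~` U : set (borel G)) by exact: measurableC.
have cx : continuous (fun g => \sum_(i < d) x i g ^+ 2).
  move=> g; apply: cvg_sumr => i _.
  have cxi : continuous (x i) by apply: smooth_continuous; have [_ /(_ i)[]] := Ux.
  exact: (continuous_at_comp (cxi g) (@exprn_continuous _ 2 _)).
have mx := continuous_measurable_borel cx.
apply/integrableP; split; first exact/measurable_EFinP.
have mnf : measurable_fun (setT : set (borel G)) (fun g => `|(f g)%:E|%E).
  by apply: measurableT_comp => //; exact/measurable_EFinP.
rewrite -(setUv (U : set (borel G))) ge0_integral_setU//; first last.
- by apply/disj_setPS; rewrite setICr.
- by rewrite setUv.
apply: lte_add_pinfty.
  (* [C] may be negative; its absolute value makes the majorant nonnegative, as the integral
     inequalities require. *)
  have C1 : 0 <= `|C| by [].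
  apply: (@le_lt_trans _ _ (\int[mu]_(g in (U : set (borel G)))
      (`|C|%:E * (\sum_(i < d) x i g ^+ 2)%:E))%E).
    apply: ge0_le_integral => //.
    - exact: measurable_funTS.
    - by apply/measurable_funTS/measurable_funeM/measurable_EFinP.
    - move=> g Ug; rewrite -EFinM lee_fin; apply: le_trans (fC g Ug) _.
      by rewrite ler_wpM2r ?ler_norm// sumr_ge0// => i _; exact: sqr_ge0.
  rewrite ge0_integralZl//; first exact: lte_mul_pinfty.
  - by apply/measurable_funTS/measurable_EFinP.
  - by move=> g _; rewrite lee_fin sumr_ge0// => i _; exact: sqr_ge0.
apply: (@le_lt_trans _ _ (\int[mu]_(g in (~` U : set (borel G))) (B%:E))%E).
  apply: ge0_le_integral => //.
  - exact: measurable_funTS.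
  - by move=> g _; rewrite lee_fin.
rewrite integral_cst//; apply: lte_mul_pinfty => //.
by rewrite lee_fin (le_trans (normr_ge0 _) (HB 1%g)).
Qed.

(** * Complex matrices through their real and imaginary parts *)

Section complex_matrices.
Variable R : rcfType.
Implicit Types z w : R[i].

Lemma ReD z w : complex.Re (z + w) = complex.Re z + complex.Re w.
Proof. by case: z w => [? ?] []. Qed.

Lemma ImD z w : complex.Im (z + w) = complex.Im z + complex.Im w.
Proof. by case: z w => [? ?] []. Qed.

Lemma ReM z w :
  complex.Re (z * w) = complex.Re z * complex.Re w - complex.Im z * complex.Im w.
Proof. by case: z w => [? ?] []. Qed.

Lemma ImM z w :
  complex.Im (z * w) = complex.Re z * complex.Im w + complex.Im z * complex.Re w.
Proof. by case: z w => [? ?] []. Qed.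

Lemma complex_eq z w :
  complex.Re z = complex.Re w -> complex.Im z = complex.Im w -> z = w.
Proof. by case: z w => [? ?] [? ?] /= -> ->. Qed.

Section part.
(** [part] stands for [Re] or [Im], so that every identity between entries is proved once for
    both. *)
Variable part : R[i] -> R.
Hypothesis partP : part = @complex.Re R \/ part = @complex.Im R.

Lemma partD z w : part (z + w) = part z + part w.
Proof. by case: partP => ->; rewrite ?ReD ?ImD. Qed.

Lemma part0 : part 0 = 0.
Proof. by case: partP => ->. Qed.

Lemma partN z : part (- z) = - part z.
Proof. by case: partP => ->; case: z. Qed.

Lemma partZ (r : R) z : part (r%:C * z) = r * part z.
Proof.
by case: partP => ->; rewrite ?ReM ?ImM /= mul0r ?subr0 ?addr0.
Qed.

Lemma part_sum (I : Type) (r : seq I) (F : I -> R[i]) :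
  part (\sum_(i <- r) F i) = \sum_(i <- r) part (F i).
Proof. exact: (big_morph part partD part0). Qed.

Section entry.
Variables (m n : nat) (a : 'I_m) (b : 'I_n).
Implicit Types A B : 'M[R[i]]_(m, n).

Lemma part_entryD A B : part ((A + B) a b) = part (A a b) + part (B a b).
Proof. by rewrite mxE partD. Qed.

Lemma part_entryN A : part ((- A) a b) = - part (A a b).
Proof. by rewrite mxE partN. Qed.

Lemma part_entryZ (r : R) A : part ((r%:C *: A) a b) = r * part (A a b).
Proof. by rewrite mxE partZ. Qed.

Lemma part_entry_sum (I : Type) (r : seq I) (F : I -> 'M[R[i]]_(m, n)) :
  part ((\sum_(k <- r) F k) a b) = \sum_(k <- r) part (F k a b).
Proof. by rewrite summxE part_sum. Qed.

Definition part_entryE := (part_entryD, part_entryN, part_entryZ, part_entry_sum).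

End entry.

(** A real functional sees only real and imaginary parts. The coefficients depend on [M] and [N] but
    not on [P], so a functional linear on such combinations commutes with multiplication by [M] and
    [N]. *)
Lemma part_mulmx (n : nat) (M N : 'M[R[i]]_n) i j : exists al be : 'I_n -> 'I_n -> R,
  forall P : 'M[R[i]]_n, part ((M *m P *m N) i j) = \sum_(k < n) \sum_(l < n)
    (al k l * complex.Re (P l k) + be k l * complex.Im (P l k)).
Proof.
have E P : part ((M *m P *m N) i j) =
    \sum_(k < n) \sum_(l < n) part (M i l * N k j * P l k).
  rewrite mxE part_sum; apply: eq_bigr => k _.
  rewrite mxE mulr_suml part_sum; apply: eq_bigr => l _.
  by rewrite mulrAC.
case: partP => ep.
  exists (fun k l => complex.Re (M i l * N k j)),
    (fun k l => - complex.Im (M i l * N k j)).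
  move=> P; rewrite E; apply: eq_bigr => k _; apply: eq_bigr => l _.
  by rewrite ep [LHS]ReM mulNr.
exists (fun k l => complex.Im (M i l * N k j)), (fun k l => complex.Re (M i l * N k j)).
move=> P; rewrite E; apply: eq_bigr => k _; apply: eq_bigr => l _.
by rewrite ep [LHS]ImM addrC.
Qed.

End part.

Lemma complex_parts_eq z w :
  (forall part : R[i] -> R, part = @complex.Re R \/ part = @complex.Im R ->
     part z = part w) -> z = w.
Proof. by move=> H; apply: complex_eq; apply: H; [left|right]. Qed.

(** The usual multiplicative embedding of complex [n]-matrices into real [2n]-matrices; its first
    block column holds both parts of every entry. *)
Definition realify (n : nat) (M : 'M[R[i]]_n) : 'M[R]_(n + n) :=
  block_mx (map_mx (@complex.Re R) M) (- map_mx (@complex.Im R) M)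
           (map_mx (@complex.Im R) M) (map_mx (@complex.Re R) M).

Lemma realifyM (n : nat) (M N : 'M[R[i]]_n) :
  realify (M *m N) = realify M *m realify N.
Proof.
rewrite /realify mulmx_block.
have EIm : map_mx (@complex.Im R) (M *m N) =
    map_mx (@complex.Im R) M *m map_mx (@complex.Re R) N +
    map_mx (@complex.Re R) M *m map_mx (@complex.Im R) N.
  apply/matrixP => i j; rewrite !mxE (part_sum (or_intror erefl)) -big_split /=.
  by apply: eq_bigr => k _; rewrite !mxE ImM addrC.
have ERe : map_mx (@complex.Re R) (M *m N) =
    map_mx (@complex.Re R) M *m map_mx (@complex.Re R) N -
    map_mx (@complex.Im R) M *m map_mx (@complex.Im R) N.
  apply/matrixP => i j; rewrite !mxE (part_sum (or_introl erefl)) -sumrB.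
  by apply: eq_bigr => k _; rewrite !mxE ReM.
rewrite EIm ERe; congr block_mx.
- by rewrite mulNmx.
- by rewrite mulmxN mulNmx opprD addrC.
- by rewrite mulmxN addrC.
Qed.

Lemma realify1 (n : nat) : realify (1%:M : 'M[R[i]]_n) = 1%:M.
Proof.
rewrite /realify.
have -> : map_mx (@complex.Re R) (1%:M : 'M[R[i]]_n) = 1%:M.
  by apply/matrixP => i j; rewrite !mxE; case: (i == j).
have -> : map_mx (@complex.Im R) (1%:M : 'M[R[i]]_n) = 0.
  by apply/matrixP => i j; rewrite !mxE; case: (i == j).
by rewrite oppr0 -scalar_mx_block.
Qed.

Lemma realify_Re (n : nat) (M : 'M[R[i]]_n) i j :
  realify M (lshift n i) (lshift n j) = complex.Re (M i j).
Proof. by rewrite block_mxEul mxE. Qed.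

Lemma realify_Im (n : nat) (M : 'M[R[i]]_n) i j :
  realify M (rshift n i) (lshift n j) = complex.Im (M i j).
Proof. by rewrite block_mxEdl mxE. Qed.

End complex_matrices.

(** * Real functionals applied to complex matrices entry by entry *)

Section entrywise_functionals.
Variables (R : realType) (n : nat).

Lemma entrywise_part (T : Type) (L : (T -> R) -> R) (F : T -> 'M[R[i]]_n)
    (part : R[i] -> R) i j :
  part = @complex.Re R \/ part = @complex.Im R ->
  part (entrywise L F i j) = L (fun t => part (F t i j)).
Proof. by case=> ->; rewrite mxE. Qed.

(** Linearity exactly on the combinations produced by [part_mulmx]: derivation at a point and the
    integral are guaranteed linear only on derivable or integrable functions. *)
Definition linear_on_entries (T : Type) (L : (T -> R) -> R)
    (F : T -> 'M[R[i]]_n) : Prop :=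
  forall al be : 'I_n -> 'I_n -> R,
  L (fun t => \sum_(k < n) \sum_(l < n)
       (al k l * complex.Re (F t l k) + be k l * complex.Im (F t l k))) =
  \sum_(k < n) \sum_(l < n)
    (al k l * L (fun t => complex.Re (F t l k)) +
     be k l * L (fun t => complex.Im (F t l k))).

Lemma entrywise_mulmx (T : Type) (L : (T -> R) -> R) (F : T -> 'M[R[i]]_n)
    (M N : 'M[R[i]]_n) :
  linear_on_entries L F ->
  entrywise L (fun t => M *m F t *m N) = M *m entrywise L F *m N.
Proof.
move=> linL; apply/matrixP => i j; apply: complex_parts_eq => part partP.
rewrite (entrywise_part _ _ _ _ partP).
have [al [be E]] := part_mulmx partP M N i j.
rewrite E; under eq_fun do rewrite E.
by rewrite linL; apply: eq_bigr => k _; apply: eq_bigr => l _; rewrite !mxE.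
Qed.

Lemma is_derive_sumr (V W : normedModType R) (m : nat) (h : 'I_m -> V -> W)
    (dh : 'I_m -> W) (x v : V) :
  (forall i, is_derive x v (h i) (dh i)) ->
  is_derive x v (fun y => \sum_(i < m) h i y) (\sum_(i < m) dh i).
Proof.
move=> H; have -> : (fun y => \sum_(i < m) h i y) = \sum_(i < m) h i.
  by apply/funext => y; rewrite fct_sumE.
exact: is_derive_sum.
Qed.

Lemma derive1_linear_on_entries (F : R -> 'M[R[i]]_n) :
  (forall i j, derivable (fun t => complex.Re (F t i j) : R) 0 (1 : R)) ->
  (forall i j, derivable (fun t => complex.Im (F t i j) : R) 0 (1 : R)) ->
  linear_on_entries (fun f : R -> R => derive1 f 0) F.
Proof.
move=> dRe dIm al be; rewrite derive1E.
suff /@derive_val -> : is_derive (0 : R) (1 : R) (fun t => \sum_(k < n) \sum_(l < n)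
    (al k l * complex.Re (F t l k) + be k l * complex.Im (F t l k)))
    (\sum_(k < n) \sum_(l < n)
      (al k l * 'D_1 (fun t => complex.Re (F t l k) : R) 0 +
       be k l * 'D_1 (fun t => complex.Im (F t l k) : R) 0)).
  by apply: eq_bigr => k _; apply: eq_bigr => l _; rewrite !derive1E.
apply: is_derive_sumr => k; apply: is_derive_sumr => l.
by apply: is_deriveD; apply: is_deriveZ; apply/derivableP.
Qed.

(** Integrability is carried along in the induction because [RintegralD] requires it of the tail. *)
Lemma Rintegral_sum d (T : measurableType d) (mu : {measure set T -> \bar R})
    (m : nat) (h : 'I_m -> T -> R) :
  (forall i, mu.-integrable setT (EFin \o h i)) ->
  mu.-integrable setT (EFin \o (fun t => \sum_(i < m) h i t)) /\
  \int[mu]_t (\sum_(i < m) h i t) = \sum_(i < m) \int[mu]_t h i t.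
Proof.
elim: m h => [|m IH] h hint.
  have -> : (fun t => \sum_(i < 0) h i t) = cst 0.
    by apply/funext => t; rewrite big_ord0.
  split; first exact: integrable0.
  by rewrite big_ord0 Rintegral_cst// mul0r.
have [int_tail val_tail] := IH (fun i => h (lift ord0 i)) (fun i => hint _).
have -> : (fun t => \sum_(i < m.+1) h i t) =
    (fun t => h ord0 t + \sum_(i < m) h (lift ord0 i) t).
  by apply/funext => t; rewrite big_ord_recl.
split; first exact (integrableD measurableT (hint ord0) int_tail).
by rewrite RintegralD// ?val_tail ?big_ord_recl//; exact: hint.
Qed.

Lemma Rintegral_linear_on_entries d (T : measurableType d)
    (mu : {measure set T -> \bar R}) (F : T -> 'M[R[i]]_n) :
  (forall i j, mu.-integrable setT (EFin \o (fun t => complex.Re (F t i j)))) ->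
  (forall i j, mu.-integrable setT (EFin \o (fun t => complex.Im (F t i j)))) ->
  linear_on_entries (fun f : T -> R => \int[mu]_t f t) F.
Proof.
move=> iRe iIm al be.
have term k l : mu.-integrable setT (EFin \o (fun t =>
      al k l * complex.Re (F t l k) + be k l * complex.Im (F t l k))) /\
    \int[mu]_t (al k l * complex.Re (F t l k) + be k l * complex.Im (F t l k)) =
    al k l * \int[mu]_t (complex.Re (F t l k)) + be k l * \int[mu]_t (complex.Im (F t l k)).
  have i1 : mu.-integrable setT (EFin \o (fun t => al k l * complex.Re (F t l k))).
    exact (integrableZl measurableT (al k l) (iRe l k)).
  have i2 : mu.-integrable setT (EFin \o (fun t => be k l * complex.Im (F t l k))).
    exact (integrableZl measurableT (be k l) (iIm l k)).
  split; first exact (integrableD measurableT i1 i2).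
  by rewrite RintegralD// !RintegralZl.
have [_ ->] := @Rintegral_sum _ _ mu n (fun k t => \sum_(l < n)
    (al k l * complex.Re (F t l k) + be k l * complex.Im (F t l k)))
  (fun k => (Rintegral_sum (fun l => (term k l).1)).1).
apply: eq_bigr => k _; have [_ ->] := Rintegral_sum (fun l => (term k l).1).
by apply: eq_bigr => l _; have [_ ->] := term k l.
Qed.

End entrywise_functionals.

(** The max norm is attained at some entry. This passes from the remainder in [|v|^2] to the sum of
    squares that a Levy measure integrates. *)
Lemma row_norm_sqr_le (R : realType) (d : nat) (v : 'rV[R]_d) :
  `|v| ^+ 2 <= \sum_(i < d) v 0 i ^+ 2.
Proof.
have sum_ge0 : 0 <= \sum_(i < d) v 0 i ^+ 2.
  by apply: sumr_ge0 => i _; exact: sqr_ge0.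
have [v0|v0] := eqVneq (mx_norm v) 0.
  by rewrite [`|v|]v0 expr0n.
have [[a i] /= E] := mx_norm_neq0 v0.
rewrite [`|v|]E (ord1 a) real_normK ?num_real// (bigD1 i)//= lerDl.
by apply: sumr_ge0 => k _; exact: sqr_ge0.
Qed.

(** * Taylor bound, derivatives and Levy integral of the unitary representation *)

Section unitary_representation.
Variables (R : realType) (d : nat) (G : lieGroupType R d).
Hypothesis Gcompact : compact [set: G].
Variables (expG : lie_algebra G -> G) (expGP : is_exponential expG).
Variables (X : 'I_d -> lie_algebra G) (U : set G) (x : 'I_d -> G -> R).
Hypothesis Ux : canonical_coordinates expG X U x.
Variables (n : nat) (p : G -> 'M[R[i]]_n).
Hypothesis p_irr : irreducible_unitary_rep p.

Let pM g h : p (g * h)%g = p g *m p h.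
Proof. by have [_ _ H _ _] := p_irr; exact: H. Qed.

Let p_unit g : p g \in unitmx.
Proof. by have [_ H _ _ _] := p_irr; exact: unitarymx_unit. Qed.

Let p1 : p 1%g = 1%:M.
Proof.
have := pM 1%g 1%g; rewrite mulg1 => /(congr1 (mulmx (invmx (p 1%g)))).
by rewrite mulVmx// mulmxA mulVmx// mul1mx => <-.
Qed.

Let realify_smooth := representation_smooth Gcompact expGP Ux
  (rho := fun g => realify (p g)).

Section part.
Variable part : R[i] -> R.
Hypothesis partP : part = @complex.Re R \/ part = @complex.Im R.

(** [part (p g i j)] is one entry of [realify (p g)], in row [lshift n i] for [Re] and [rshift n i]
    for [Im]; [representation_smooth] applies to that real representation. *)
Lemma unitary_rep_part_taylor i j : smooth (fun g => part (p g i j)) /\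
  exists C, forall v : 'rV[R]_d,
    `|part (p (exp_coord expG X v) i j) - part ((1%:M : 'M[R[i]]_n) i j) -
      \sum_(k < d) v 0 k * X k (fun g => part (p g i j))| <= C * `|v| ^+ 2.
Proof.
have rhoM g h : realify (p (g * h)%g) = realify (p g) *m realify (p h).
  by rewrite pM realifyM.
have rho1 : realify (p 1%g) = 1%:M by rewrite p1 realify1.
have rho_cont : continuous (fun g => realify (p g)).
  have [_ _ _ cp _] := p_irr.
  move=> g; apply: cvg_mx_entries => a b.
  have [cRe cIm] : (forall a b, {for g, continuous (fun g => complex.Re (p g a b) : R)}) /\
     (forall a b, {for g, continuous (fun g => complex.Im (p g a b) : R)}).
    by split=> a' b'; have [H1 H2] := cp a' b'; [exact: H1|exact: H2].
  rewrite /realify -[a]splitK -[b]splitK.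
  case: (fintype.split a) => a'; case: (fintype.split b) => b' /=.
  - by under eq_fun do rewrite block_mxEul mxE; rewrite block_mxEul mxE; exact: cRe.
  - under eq_fun do rewrite block_mxEur !mxE; rewrite block_mxEur !mxE.
    by apply: cvgN; exact: cIm.
  - by under eq_fun do rewrite block_mxEdl mxE; rewrite block_mxEdl mxE; exact: cIm.
  - by under eq_fun do rewrite block_mxEdr mxE; rewrite block_mxEdr mxE; exact: cRe.
have [srho [C HC]] := realify_smooth rhoM rho1 rho_cont.
have [a [b Eab]] : exists a b, forall M : 'M[R[i]]_n, realify M a b = part (M i j).
  case: partP => ->.
    by exists (lshift n i), (lshift n j) => M; exact: realify_Re.
  by exists (rshift n i), (lshift n j) => M; exact: realify_Im.
have E : (fun g => part (p g i j)) = (fun g => realify (p g) a b).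
  by apply/funext => g; rewrite Eab.
rewrite E; split; first exact: srho.
exists C => v; apply: le_trans (HC v); apply: le_trans (mx_entry_le_norm _ a b).
by rewrite -realify1 -!Eab !mxE.
Qed.

Lemma derived_rep_part k i j :
  part (derived_rep expG p (X k) i j) = X k (fun g => part (p g i j)).
Proof.
have [sp _] := unitary_rep_part_taylor i j.
rewrite /derived_rep (entrywise_part _ _ _ _ partP) derive1E.
by have [_ _ /(_ _ sp)[_ <-]] := expGP (X k).
Qed.

End part.

Let path_linear k : linear_on_entries (fun f : R -> R => derive1 f 0)
  (fun u : R => p (expG (u *: X k))).
Proof.
apply: derive1_linear_on_entries => i j.
  have [sp _] := unitary_rep_part_taylor (or_introl erefl) i j.
  by have [_ _ /(_ _ sp)[]] := expGP (X k).
have [sp _] := unitary_rep_part_taylor (or_intror erefl) i j.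
by have [_ _ /(_ _ sp)[]] := expGP (X k).
Qed.

(** Multiplicativity of [p] moves [p s] out of the derivative. The factor [N] makes the formula
    iterable: the result is again [p s] times a constant matrix, which is what the second-order
    terms need. *)
Lemma left_field_unitary_rep (part : R[i] -> R) (N : 'M[R[i]]_n) k i j s :
  part = @complex.Re R \/ part = @complex.Im R ->
  left_field expG (X k) (fun g => part ((p g *m N) i j)) s =
  part ((p s *m derived_rep expG p (X k) *m N) i j).
Proof.
move=> partP; rewrite -(entrywise_mulmx (p s) N (@path_linear k)).
rewrite (entrywise_part _ _ _ _ partP) /left_field.
by under eq_fun do rewrite pM.
Qed.

(** For [g] in [U], [exp_coord] of the coordinates of [g] is [g], so the integrand is there the
    Taylor remainder of [p] at that row of coordinates, small or not. *)
Lemma levy_integrand_integrable (part : R[i] -> R)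
    (mu : {measure set (borel G) -> \bar R}) i j :
  part = @complex.Re R \/ part = @complex.Im R -> levy_measure expG X mu ->
  mu.-integrable [set: borel G] (EFin \o (fun t : G => part ((p t - 1%:M
     - \sum_(k < d) (x k t)%:C *: derived_rep expG p (X k)) i j))).
Proof.
move=> partP mu_levy.
have [sp [C HC]] := unitary_rep_part_taylor partP i j.
have E t : part ((p t - 1%:M
     - \sum_(k < d) (x k t)%:C *: derived_rep expG p (X k)) i j) =
   part (p t i j) - part ((1%:M : 'M[R[i]]_n) i j) -
      \sum_(k < d) x k t * X k (fun g => part (p g i j)).
  rewrite !(part_entryE partP); congr (_ - _ - _).
  by apply: eq_bigr => k _; rewrite (part_entryZ partP) derived_rep_part.
apply: (@levy_integrable _ _ _ expG X U x mu _ `|C|) => //.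
  have -> : (fun t : G => part ((p t - 1%:M
     - \sum_(k < d) (x k t)%:C *: derived_rep expG p (X k)) i j)) = (fun t =>
   part (p t i j) - part ((1%:M : 'M[R[i]]_n) i j) -
      \sum_(k < d) x k t * X k (fun g => part (p g i j))) by apply/funext.
  move=> t; apply: cvgB.
    by apply: cvgB; [exact: (smooth_continuous sp)|exact: cvg_cst].
  apply: cvg_sumr => k _; apply: cvgMr_tmp; apply: smooth_continuous.
  by have [_ /(_ k)[]] := Ux.
move=> g Ug; rewrite E.
have := HC (\row_k x k g); rewrite (exp_coord_coords Ux Ug).
under eq_bigr do rewrite mxE.
move=> /le_trans; apply.
apply: (@le_trans _ _ (`|C| * `|\row_k x k g| ^+ 2)).
  by rewrite ler_wpM2r ?sqr_ge0// ler_norm.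
rewrite ler_wpM2l//; apply: le_trans (row_norm_sqr_le _) _.
by under eq_bigr do rewrite mxE.
Qed.

Lemma levy_integral_linear (mu : {measure set (borel G) -> \bar R}) :
  levy_measure expG X mu ->
  linear_on_entries (fun f : G -> R => \int[mu]_t f t)
    (fun t : G => p t - 1%:M
       - \sum_(k < d) (x k t)%:C *: derived_rep expG p (X k)).
Proof.
move=> mu_levy; apply: (@Rintegral_linear_on_entries _ _ _ (borel G) mu).
  by move=> i j; apply: levy_integrand_integrable => //; left.
by move=> i j; apply: levy_integrand_integrable => //; right.
Qed.

Lemma symbol_unit (A : (G -> R) -> G -> R) (s : G) (M : 'M[R[i]]_n) :
  entrywise (fun f : G -> R => A f s) p = p s *m M -> symbol A s p = M.
Proof. by move=> E; rewrite /symbol E mulKmx. Qed.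

End unitary_representation.

Theorem proposition5p1 (R : realType) (d : nat) (G : lieGroupType R d)
  (Gcompact : compact [set: G])
  (expG : lie_algebra G -> G) (expGP : is_exponential expG)
  (X : 'I_d -> lie_algebra G) (Xbasis : is_basis X)
  (U : set G) (x : 'I_d -> G -> R)
  (Ux : canonical_coordinates expG X U x)
  (A : (G -> R) -> G -> R)
  (A_linear : linear_on_smooth A)
  (A_continuous : forall f : G -> R, smooth f -> continuous (A f))
  (A_pmp : positive_maximum_principle A)
  (c : G -> R) (b : 'I_d -> G -> R) (a : 'I_d -> 'I_d -> G -> R)
  (mu : G -> {measure set (borel G) -> \bar R})
  (c_ge0 : forall s, 0 <= c s)
  (a_sym : forall s j k, a j k s = a k j s)
  (a_ge0 : forall s (v : 'I_d -> R),
    0 <= \sum_(j < d) \sum_(k < d) a j k s * v j * v k)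
  (mu_levy : forall s, levy_measure expG X (mu s))
  (A_form : forall (f : G -> R) (s : G), smooth f ->
    A f s =
      - c s * f s
      + \sum_(i < d) b i s * left_field expG (X i) f s
      + \sum_(j < d) \sum_(k < d)
          a j k s * left_field expG (X j) (left_field expG (X k) f) s
      + \int[mu s]_t (f (s * t)%g - f s
          - \sum_(i < d) x i t * left_field expG (X i) f s))
  (a_cont : forall j k, continuous (a j k))
  (b_cont : forall i, continuous (b i))
  (c_cont : continuous c)
  (mu_cont_U : forall h : G -> R, bounded_continuous_on U h ->
    continuous (fun g : G =>
      \int[mu g]_(t in (U : set (borel G)))
        (h t * \sum_(i < d) x i t ^+ 2) : R))
  (mu_cont_Uc : forall k : G -> R, bounded_continuous_on (~` U) k ->
    continuous (fun g : G =>
      \int[mu g]_(t in (~` U : set (borel G))) k t : R)) :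
  forall (n : nat) (p : G -> 'M[R[i]]_n), irreducible_unitary_rep p ->
  forall s : G,
    symbol A s p =
      - ((c s)%:C)%:M
      + \sum_(i < d) (b i s)%:C *: derived_rep expG p (X i)
      + \sum_(j < d) \sum_(k < d)
          (a j k s)%:C *: (derived_rep expG p (X j)
                            *m derived_rep expG p (X k))
      + entrywise (fun f : G -> R => \int[mu s]_t f t)
          (fun t : G => p t - 1%:M
             - \sum_(i < d) (x i t)%:C *: derived_rep expG p (X i)).
Proof.
move=> n p p_irr s; apply: (symbol_unit p_irr).
apply/matrixP => i j; apply: complex_parts_eq => part partP.
pose D k := derived_rep expG p (X k).
rewrite (entrywise_part _ _ _ _ partP).
have [sp _] := unitary_rep_part_taylor Gcompact expGP Ux p_irr partP i j.
(* A general [N] is kept: [N = 1] gives the first-order terms, [N = D k] the second-order ones. *)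
have LF N k g : left_field expG (X k) (fun g => part ((p g *m N) i j)) g =
    part ((p g *m D k *m N) i j).
  exact: (left_field_unitary_rep Gcompact expGP Ux p_irr).
have LF1 k g : left_field expG (X k) (fun g => part (p g i j)) g =
    part ((p g *m D k) i j).
  by have := LF 1%:M k g; rewrite mulmx1; under eq_fun do rewrite mulmx1.
have LF2 l k : left_field expG (X l)
    (left_field expG (X k) (fun g => part (p g i j))) s =
    part ((p s *m (D l *m D k)) i j).
  by rewrite (funext (LF1 k)) LF mulmxA.
(* Left multiplication by the constant [p s] goes through the integral, where it turns [p t] into
   [p (s * t)] and each [D k] into the action of [X k] at [s]. *)
have levy : part ((p s *m entrywise (fun f : G -> R => \int[mu s]_t f t)
      (fun t : G => p t - 1%:M - \sum_(k < d) (x k t)%:C *: D k)) i j) =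
    \int[mu s]_t (part (p (s * t)%g i j) - part (p s i j)
          - \sum_(k < d) x k t * left_field expG (X k) (fun g => part (p g i j)) s).
  rewrite -[p s *m _]mulmx1 -entrywise_mulmx; last first.
    exact: (levy_integral_linear Gcompact expGP Ux p_irr).
  rewrite (entrywise_part _ _ _ _ partP); congr (Rintegral _ _ _).
  apply/funext => t; rewrite mulmx1 !mulmxBr mulmx1 mulmx_sumr.
  have [_ _ pM _ _] := p_irr; rewrite pM !(part_entryE partP).
  congr (_ - _ - _); apply: eq_bigr => k _.
  by rewrite -scalemxAr (part_entryZ partP) LF1.
rewrite (A_form _ s sp) !mulmxDr !(part_entryE partP) levy; congr (_ + _ + _ + _).
- by rewrite mulmxN mul_mx_scalar (part_entryN partP) (part_entryZ partP) mulNr.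
- rewrite mulmx_sumr (part_entry_sum partP); apply: eq_bigr => k _.
  by rewrite -scalemxAr (part_entryZ partP) LF1.
- rewrite mulmx_sumr (part_entry_sum partP); apply: eq_bigr => l _.
  rewrite mulmx_sumr (part_entry_sum partP); apply: eq_bigr => k _.
  by rewrite -scalemxAr (part_entryZ partP) LF2.
Qed.
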